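(* Let $(M,g)$ be a connected Riemannian surface, $G$ a nondegenerate $g$-natural metric on $TM$ defined by functions $\alpha_i,\beta_i$ ($i=1,2,3$), and $x\in M$. Let $H\in T_xM$ be such that the horizontal lift $H^h_{(x,0_x)}$ is a unit vector, i.e. $G_{(x,0_x)}(H^h,H^h)=1$. Then the spectrum of the Jacobi operator $\bar J_{H^h_{(x,0_x)}}$ of $(TM,G)$ is the set $$\Big\{0,\ \frac{k(x)}{(\alpha_1+\alpha_3)(0)},\ -\frac{f_6^B(0)+k(x)(f_1^B+f_2^B)(0)}{(\alpha_1+\alpha_3)(0)},\ -\frac{(f_4^B+f_5^B+f_6^B)(0)}{(\alpha_1+\alpha_3)(0)}\Big\}.$$
   Context: Lifts: the Levi-Civita connection $\nabla$ of $g$ splits $T_{(x,u)}TM$ into horizontal and vertical subspaces. For $X\in T_xM$, $X^h$ and $X^v$ (also $h\{X\}$ and $v\{X\}$) denote the horizontal and vertical lifts of $X$ to $(x,u)$. $g$-natural metrics: a $g$-natural metric $G$ on $TM$ is given by smooth functions $\alpha_i,\beta_i:[0,\infty)\to\mathbb R$, $i=1,2,3$: for $x\in M$, $u,X,Y\in T_xM$, $t=g(u,u)$ (lifts at $(x,u)$), $G(X^h,Y^h)=(\alpha_1+\alpha_3)(t)g(X,Y)+(\beta_1+\beta_3)(t)g(X,u)g(Y,u)$; $G(X^h,Y^v)=G(X^v,Y^h)=\alpha_2(t)g(X,Y)+\beta_2(t)g(X,u)g(Y,u)$; $G(X^v,Y^v)=\alpha_1(t)g(X,Y)+\beta_1(t)g(X,u)g(Y,u)$.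 ''Nondegenerate'' means nondegenerate at every point of $TM$. Curvature: $R(X,Y)=[\nabla_X,\nabla_Y]-\nabla_{[X,Y]}$ (same convention on $TM$). The Jacobi operator of a tangent vector $X$ is $J_X(Y)=R(X,Y)X$; those of $(TM,G)$ are written $\bar J$. On the surface, $\mathbf i$ denotes rotation by $\pi/2$ in $T_xM$ (for either local orientation) and $k$ is the function with $R(X,Y)Z=k(x)\,g(\mathbf iX,Y)\,\mathbf iZ$ for all $X,Y,Z\in T_xM$. With this curvature convention $k$ is the negative of the usual Gaussian curvature. The functions $f_i^P$: put $T^1(u;X,Y)=R(X,u)Y$, $T^2(u;X,Y)=R(Y,u)X$, $T^3(u;X,Y)=g(R(X,u)Y,u)u$, $T^4(u;X,Y)=g(X,u)Y$, $T^5(u;X,Y)=g(Y,u)X$, $T^6(u;X,Y)=g(X,Y)u$, $T^7(u;X,Y)=g(X,u)g(Y,u)u$. The Levi-Civita connection $\bar\nabla$ of $G$ satisfies, for vector fields $X,Y$ on $M$, at $(x,u)$: $\bar\nabla_{X^h}Y^h=(\nabla_XY)^h+h\{A(u;X,Y)\}+v\{B(u;X,Y)\}$, $\bar\nabla_{X^h}Y^v=(\nabla_XY)^v+h\{C(u;X,Y)\}+v\{D(u;X,Y)\}$, $\bar\nabla_{X^v}Y^h=h\{C(u;Y,X)\}+v\{D(u;Y,X)\}$, $\bar\nabla_{X^v}Y^v=h\{E(u;Y,X)\}+v\{F(u;Y,X)\}$, where $P(u;X,Y)=\sum_{i=1}^7 f_i^P(g(u,u))\,T^i(u;X,Y)$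 for $P=A,B,C,D,E,F$. Here the $f_i^P:[0,\infty)\to\mathbb R$ are the smooth functions depending only on $\alpha_1,\alpha_2,\alpha_3,\beta_1,\beta_2,\beta_3$ which are uniquely determined by requiring these formulas to hold for every Riemannian manifold of dimension $\ge 2$ whose tangent bundle carries the $g$-natural metric defined by these same functions $\alpha_i,\beta_i$. *)

(* Defs.v *)
From HB Require Import structures.
From mathcomp Require Import all_boot all_order all_algebra.
From mathcomp Require Import all_classical all_reals all_analysis.
From mathcomp Require Import complex ring lra.

Set Implicit Arguments.
Unset Strict Implicit.
Unset Printing Implicit Defensive.

Import Order.TTheory GRing.Theory Num.Theory.
Import numFieldNormedType.Exports.

Local Open Scope classical_set_scope.
Local Open Scope ring_scope.

Fixpoint Ck (R : realType) (V W : normedModType R) (k : nat)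
    (U : set V) (f : V -> W) : Prop :=
  match k with
  | 0 => forall x, U x -> {for x, continuous f}
  | k'.+1 => (forall x, U x -> differentiable f x) /\
             (forall v, Ck k' U (fun x => 'D_v f x))
  end.

Definition smooth (R : realType) (V W : normedModType R)
    (U : set V) (f : V -> W) : Prop := forall k, Ck k U f.

(* Smoothness on [0, +oo[, a closed set, is the existence of a smooth
   extension; the values at negative arguments are irrelevant. *)
Definition smooth_ge0 (R : realType) (f : R -> R) : Prop :=
  exists2 F : R -> R, smooth setT F & forall t, 0 <= t -> F t = f t.

Section SmoothTheory.
Variable R : realType.
Implicit Types V W Z : normedModType R.

Lemma near_eq_differentiable V W (f g : V -> W) x :
  (\near x, f x = g x) -> differentiable f x -> differentiable g x.
Proof.
move=> fg /diff_locallyP[cd fd].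
have gd : g \o shift x = cst (g x) + 'd f x +o_ 0 id.
  move: fd => /eqaddoP fd; apply/eqaddoP => e e0.
  have nfg : \forall h \near (0 : V), f (h + x) = g (h + x).
    by move: fg; rewrite (near_shift 0 x)/=; apply: filterS => h; rewrite /= subr0.
  move: (fd e e0); apply: filterS2 nfg => h /= hE.
  by rewrite /= !fctE hE (nbhs_singleton fg).
have dE := diff_unique cd gd.
by apply/diff_locallyP; rewrite dE; split.
Qed.

Lemma Ck_eq V W k (U : set V) (f g : V -> W) : open U ->
  (forall x, U x -> f x = g x) -> Ck k U f -> Ck k U g.
Proof.
move=> Uo; elim: k f g => [|k IH] f g fg /=.
  move=> cf x Ux; have nfg : \near x, f x = g x.
    by near=> y; apply: fg; near: y; apply: open_nbhs_nbhs.
  have := cf x Ux; rewrite /prop_for /continuous_at (fg _ Ux) => h.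
  apply: cvg_trans h; apply: near_eq_cvg.
  by apply: filterS nfg => y ->.
have nfg x : U x -> \near x, f x = g x.
  by move=> Ux; near=> y; apply: fg; near: y; apply: open_nbhs_nbhs.
move=> [df Df]; split=> [x Ux|v].
  exact: near_eq_differentiable (nfg _ Ux) (df _ Ux).
by apply: IH (Df v) => x Ux; apply: near_eq_derive; apply: nfg.
Unshelve. all: by end_near. Qed.

Lemma Ck_continuous V W k (U : set V) (f : V -> W) : Ck k U f ->
  forall x, U x -> {for x, continuous f}.
Proof.
by case: k => [//|k] [df _] x Ux; apply: differentiable_continuous; apply: df.
Qed.

Lemma CkW V W k (U : set V) (f : V -> W) : Ck k.+1 U f -> Ck k U f.
Proof.
elim: k f => [|k IH] f; first exact: Ck_continuous.
by move=> [df Df]; split=> // v; apply: IH.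
Qed.

Lemma CkD V W k (U : set V) (f g : V -> W) : open U ->
  Ck k U f -> Ck k U g -> Ck k U (fun x => f x + g x).
Proof.
move=> Uo; elim: k f g => [|k IH] f g /=.
  by move=> cf cg x Ux; apply: continuousD; [exact: cf|exact: cg].
move=> [df Df] [dg Dg]; split=> [x Ux|v].
  by apply: differentiableD; [exact: df|exact: dg].
apply: Ck_eq (IH _ _ (Df v) (Dg v)) => // x Ux.
by rewrite -[LHS]deriveD //; apply: diff_derivable; [exact: df|exact: dg].
Qed.

Lemma Ck_cst V W k (U : set V) (w : W) : Ck k U (fun=> w).
Proof.
elim: k w => [|k IH] w /=; first by move=> x _; exact: cst_continuous.
split=> [x _|v]; first exact: differentiable_cst.
suff -> : (fun x => 'D_v (fun=> w) x) = (fun=> 0 : W) by exact: IH.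
by apply/funext => x; exact: derive_cst.
Qed.

Lemma CkZ V W k (U : set V) (c : R) (f : V -> W) : open U ->
  Ck k U f -> Ck k U (fun x => c *: f x).
Proof.
move=> Uo; elim: k f => [|k IH] f /=.
  by move=> cf x Ux; apply: continuous_comp; [exact: cf|exact: scaler_continuous].
move=> [df Df]; split=> [x Ux|v]; first by apply: differentiableZ; exact: df.
apply: Ck_eq (IH _ (Df v)) => // x Ux.
by rewrite -[LHS]deriveZ //; apply: diff_derivable; exact: df.
Qed.

Lemma Ck_sum V W k (U : set V) n (f : 'I_n -> V -> W) : open U ->
  (forall i, Ck k U (f i)) -> Ck k U (fun x => \sum_(i < n) f i x).
Proof.
move=> Uo; elim: n f => [|n IH] f hf.
  by apply: Ck_eq (Ck_cst k U 0) => // x _; rewrite big_ord0.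
apply: Ck_eq (CkD Uo (IH (fun i => f (widen_ord (leqnSn n) i)) _) (hf ord_max)) => //.
by move=> x _; rewrite big_ord_recr.
Qed.

Lemma Ck_comp_linear V W Z k (U : set W) (f : W -> Z) (l : {linear V -> W}) :
  continuous l -> Ck k U f -> Ck k (l @^-1` U) (fun x => f (l x)).
Proof.
move=> cl; elim: k f => [|k IH] f /=.
  move=> cf x Ux; apply: continuous_comp; [exact: cl|exact: cf].
move=> [df Df]; split=> [x Ux|v].
  by apply: differentiable_comp; [exact: linear_differentiable|exact: df].
suff -> : (fun x => 'D_v (fun x => f (l x)) x) = (fun x => 'D_(l v) f (l x)).
  exact: (IH (fun y => 'D_(l v) f y)).
apply/funext => x; rewrite /derive; apply: (congr1 (fun g : R -> Z => lim (g @ 0^'))).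
by apply/funext => h /=; rewrite [l _]linearD [l (h *: v)]linearZ_LR.
Qed.

Lemma Ck_linear_comp V W Z k (U : set V) (f : V -> W) (l : {linear W -> Z}) :
  open U -> continuous l -> Ck k U f -> Ck k U (fun x => l (f x)).
Proof.
move=> Uo cl; elim: k f => [|k IH] f /=.
  move=> cf x Ux; apply: continuous_comp; [exact: cf|exact: cl].
have dl y : differentiable l y by apply: linear_differentiable.
move=> [df Df]; split=> [x Ux|v].
  by apply: differentiable_comp; [exact: df|].
apply: Ck_eq (IH _ (Df v)) => // x Ux.
have dfx := df x Ux.
rewrite (deriveE v (differentiable_comp dfx (dl (f x)))) deriveE //.
have -> := diff_comp dfx (dl (f x)).
by have -> := diff_lin (f x) cl.
Qed.

Lemma derive_linear V W (l : {linear V -> W}) (x v : V) :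
  continuous l -> 'D_v l x = l v.
Proof.
move=> cl; rewrite (deriveE v (linear_differentiable x cl)).
by have -> := diff_lin x cl.
Qed.

Lemma Ck_linear V W k (U : set V) (l : {linear V -> W}) :
  continuous l -> Ck k U l.
Proof.
move=> cl; case: k => [|k] /=; first by move=> x _; exact: cl.
split=> [x _|v]; first exact: linear_differentiable.
suff -> : (fun x => 'D_v l x) = (fun=> l v) by exact: Ck_cst.
by apply/funext => x; exact: derive_linear.
Qed.

Lemma Ck_mul_linear V k (U : set V) (l : {linear V -> R}) (f : V -> R) :
  open U -> continuous l -> Ck k U f -> Ck k U (fun x => l x * f x).
Proof.
move=> Uo cl; elim: k f => [|k IH] f /=.
  by move=> cf x Ux; apply: continuousM; [exact: cl|exact: cf].
have dl y : differentiable l y by apply: linear_differentiable.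
move=> [df Df]; split=> [x Ux|v].
  by apply: differentiableM => //; exact: df.
have Cf : Ck k U (fun x => l v *: f x) by apply: CkZ => //; apply: CkW; split.
apply: Ck_eq (CkD Uo Cf (IH _ (Df v))) => // x Ux.
have -> : 'D_v (fun x => l x * f x) x = l x *: 'D_v f x + f x *: 'D_v l x.
  by apply: deriveM; apply: diff_derivable => //; apply: df.
by rewrite (derive_linear _ _ cl) addrC; congr (_ + _); exact: mulrC.
Qed.

End SmoothTheory.

Lemma Ck_delta_sum (R : realType) (V : normedModType R) n k (U : set V)
    (f : V -> 'rV[R]_n) : open U ->
  (forall j, Ck k U (fun x => f x 0 j)) -> Ck k U f.
Proof.
move=> Uo hf.
have lin j : linear (fun c : R => c *: (delta_mx 0 j : 'rV[R]_n)).
  by move=> a u v; rewrite scalerDl scalerA.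
have h j : Ck k U (fun x => f x 0 j *: (delta_mx 0 j : 'rV[R]_n)).
  pose lM := GRing.isLinear.Build _ _ _ _ _ (lin j).
  pose L : {linear R -> 'rV[R]_n} := HB.pack (fun c : R => c *: (delta_mx 0 j : 'rV[R]_n)) lM.
  exact: (@Ck_linear_comp _ _ _ _ k U (fun x => f x 0 j) L Uo (@scalel_continuous _ _ _) (hf j)).
apply: Ck_eq (Ck_sum Uo h) => // x _.
by rewrite [RHS]row_sum_delta.
Qed.

Lemma coord_is_linear (R : realType) n (j : 'I_n) :
  linear (fun v : 'rV[R]_n => v 0 j : R).
Proof. by move=> a u v; rewrite !mxE. Qed.

Definition coord_lin (R : realType) n (j : 'I_n) : {linear 'rV[R]_n -> R} :=
  HB.pack (fun v : 'rV[R]_n => v 0 j : R)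
    (GRing.isLinear.Build _ _ _ _ _ (@coord_is_linear R n j)).

Lemma coord_lin_continuous (R : realType) n (j : 'I_n) :
  continuous (coord_lin R j).
Proof. exact: coord_continuous. Qed.

Lemma Ck_tangent_map (R : realType) n k (U : set 'rV[R]_n)
    (f : 'rV[R]_n -> 'rV[R]_n) : open U -> smooth U f ->
  Ck k (lsubmx @^-1` U)
    (fun z : 'rV[R]_(n + n) => row_mx (f (lsubmx z)) ('D_(rsubmx z) f (lsubmx z))).
Proof.
move=> Uo sf.
have cl : continuous (lsubmx : 'rV[R]_(n + n) -> 'rV[R]_n) by exact: continuous_lsubmx.
have cr : continuous (rsubmx : 'rV[R]_(n + n) -> 'rV[R]_n) by exact: continuous_rsubmx.
have Uo' : open ((lsubmx : 'rV[R]_(n + n) -> 'rV[R]_n) @^-1` U).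
  by move/continuousP: cl; apply.
apply: Ck_delta_sum => // j.
rewrite -(splitK j); case: (fintype.split j) => j' /=.
  apply: (@Ck_eq _ _ _ _ _ (fun z => coord_lin R j' (f (lsubmx z)))) => //.
    by move=> x _; rewrite row_mxEl.
  apply: (@Ck_linear_comp _ _ _ _ k _ (fun z => f (lsubmx z))) => //.
    exact: coord_lin_continuous.
  exact: (Ck_comp_linear cl (sf k)).
apply: (@Ck_eq _ _ _ _ _ (fun z => \sum_(i < n) coord_lin R i (rsubmx z) *
   coord_lin R j' ('D_(delta_mx 0 i) f (lsubmx z)))) => //.
  move=> x Ux; rewrite row_mxEr.
  have df : differentiable f (lsubmx x) by have [df _] := sf 1%N; apply: df.
  rewrite deriveE // [in RHS](row_sum_delta (rsubmx x)) linear_sum /= summxE.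
  by apply: eq_bigr => i _; rewrite linearZ /= deriveE // [RHS]mxE.
apply: Ck_sum => // i.
pose L := coord_lin R i \o (rsubmx : 'rV[R]_(n + n) -> 'rV[R]_n).
apply: (@Ck_mul_linear _ _ _ _ L) => //.
  move=> x; apply: continuous_comp; [exact: cr|exact: coord_lin_continuous].
apply: (@Ck_linear_comp _ _ _ _ k _ (fun z => 'D_(delta_mx 0 i) f (lsubmx z))) => //.
  exact: coord_lin_continuous.
apply: (Ck_comp_linear cl (f := 'D_(delta_mx 0 i) f)).
by have [_ Df] := sf k.+1; exact: Df.
Qed.

Lemma derive_comp (R : realType) (V W Z : normedModType R) (f : V -> W)
    (g : W -> Z) (x v : V) : differentiable f x -> differentiable g (f x) ->
  'D_v (g \o f) x = 'D_('D_v f x) g (f x).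
Proof.
move=> df dg; rewrite (deriveE v (differentiable_comp df dg)).
by have -> := diff_comp df dg; rewrite !deriveE.
Qed.

(* Open sets of the topology that an atlas induces on the underlying set. *)
Definition atlas_open (R : realType) (n : nat) (T I : Type)
    (dom : I -> set T) (phi : I -> T -> 'rV[R]_n) (A : set T) : Prop :=
  forall i, open (phi i @` (A `&` dom i)).

(* A smooth n-manifold, given by a set with an atlas; the topology is the
   induced one.  [ctr i j] is the transition map from chart [i] to chart [j];
   it is meaningful only on the image in chart [i] of the overlap. *)
Record manifold (R : realType) (n : nat) := Manifold {
  mpoint :> Type;
  chart : Type;
  cdom : chart -> set mpoint;
  cmap : chart -> mpoint -> 'rV[R]_n;
  ctr : chart -> chart -> 'rV[R]_n -> 'rV[R]_n;
  cdom_cover : forall x, exists i, cdom i x;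
  cmap_inj : forall i x y,
    cdom i x -> cdom i y -> cmap i x = cmap i y -> x = y;
  overlap_open : forall i j, open (cmap i @` (cdom i `&` cdom j));
  ctr_cmap : forall i j x,
    cdom i x -> cdom j x -> ctr i j (cmap i x) = cmap j x;
  ctr_smooth : forall i j, smooth (cmap i @` (cdom i `&` cdom j)) (ctr i j);
  manifold_hausdorff : forall x y, x <> y ->
    exists A B : set mpoint, [/\ atlas_open cdom cmap A,
      atlas_open cdom cmap B, A x, B y & A `&` B = set0];
  manifold_second_countable : exists C : set chart,
    countable C /\ forall x, exists2 i, C i & cdom i x
}.

Definition connected_manifold (R : realType) (n : nat) (M : manifold R n) :=
  forall A : set M, atlas_open (@cdom _ _ M) (@cmap _ _ M) A ->
    atlas_open (@cdom _ _ M) (@cmap _ _ M) (~` A) -> A = set0 \/ A = setT.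

(* A tangent vector at x is the family of its components in the charts at x,
   related by the differentials of the transition maps. *)
Record tangent (R : realType) (n : nat) (M : manifold R n) (x : M) := Tangent {
  tcomp :> chart M -> 'rV[R]_n;
  tcomp_ctr : forall i j, cdom i x -> cdom j x ->
    tcomp j = 'D_(tcomp i) (ctr i j) (cmap i x);
  tcomp_out : forall i, ~ cdom i x -> tcomp i = 0
}.

Section TangentBundle.
Variables (R : realType) (n : nat) (M : manifold R n).

Lemma tangent_eq (x : M) (u v : tangent x) i :
  cdom i x -> u i = v i -> u = v.
Proof.
move=> ix uv; have : tcomp u = tcomp v.
  apply/funext => j; have [jx|jx] := pselect (cdom j x).
    by rewrite (tcomp_ctr u ix jx) (tcomp_ctr v ix jx) uv.
  by rewrite !tcomp_out.
case: u v {uv} => [u u1 u2] [v v1 v2] /= E; move: u1 u2 v1 v2; rewrite E => *.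
by congr Tangent; exact: Prop_irrelevance.
Qed.

Lemma zero_tangent_ctr (x : M) (i j : chart M) : cdom i x -> cdom j x ->
  (0 : 'rV[R]_n) = 'D_0 (ctr i j) (cmap i x).
Proof. by rewrite derive0. Qed.

Definition zero_tangent (x : M) : tangent x :=
  @Tangent R n M x (fun=> 0) (@zero_tangent_ctr x) (fun _ _ => erefl).

Lemma ctr_differentiable (i j : chart M) (x : M) : cdom i x -> cdom j x ->
  differentiable (ctr i j) (cmap i x).
Proof. by move=> ix jx; have [+ _] := ctr_smooth i j 1; apply; exists x. Qed.

Lemma ctr_comp (i j l : chart M) (x : M) v :
  cdom i x -> cdom j x -> cdom l x ->
  'D_('D_v (ctr i j) (cmap i x)) (ctr j l) (cmap j x) = 'D_v (ctr i l) (cmap i x).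
Proof.
move=> ix jx lx; rewrite -(ctr_cmap ix jx) -derive_comp; first last.
- by rewrite (ctr_cmap ix jx); exact: ctr_differentiable.
- exact: ctr_differentiable.
apply: near_eq_derive.
have Oij : open_nbhs (cmap i x) (cmap i @` (cdom i `&` cdom j)).
  by split; [exact: overlap_open|exists x].
have Oil : open_nbhs (cmap i x) (cmap i @` (cdom i `&` cdom l)).
  by split; [exact: overlap_open|exists x].
near=> y.
have [y1 [iy1 jy1] e1] : (cmap i @` (cdom i `&` cdom j)) y.
  by near: y; exact: open_nbhs_nbhs.
have [y2 [iy2 ly2] e2] : (cmap i @` (cdom i `&` cdom l)) y.
  by near: y; exact: open_nbhs_nbhs.
have e12 : y1 = y2 by apply: (cmap_inj iy1 iy2); rewrite e1.
by subst y2; rewrite /= -e1 !ctr_cmap.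
Unshelve. all: by end_near. Qed.

Lemma ctr_id (i : chart M) (x : M) v :
  cdom i x -> 'D_v (ctr i i) (cmap i x) = v.
Proof.
move=> ix; rewrite -[RHS](derive_id (cmap i x) v); apply: near_eq_derive.
have O : open_nbhs (cmap i x) (cmap i @` (cdom i `&` cdom i)).
  by split; [exact: overlap_open|exists x].
near=> y.
have [y1 [iy1 _] e1] : (cmap i @` (cdom i `&` cdom i)) y.
  by near: y; exact: open_nbhs_nbhs.
by rewrite -e1 ctr_cmap.
Unshelve. all: by end_near. Qed.

Lemma tangent_ex (i : chart M) (x : M) (v : 'rV[R]_n) :
  cdom i x -> exists u : tangent x, u i = v.
Proof.
move=> ix.
pose f j := if pselect (cdom j x) then 'D_v (ctr i j) (cmap i x) else 0.
have f1 j l : cdom j x -> cdom l x -> f l = 'D_(f j) (ctr j l) (cmap j x).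
  move=> jx lx; rewrite /f; do 2?case: pselect => // ?; by rewrite ctr_comp.
have f2 j : ~ cdom j x -> f j = 0 by rewrite /f; case: pselect.
by exists (Tangent f1 f2); rewrite /= /f; case: pselect => // ?; exact: ctr_id.
Qed.

Let TM := {x : M & tangent x}.
Let tdom (i : chart M) : set TM := [set p | cdom i (projT1 p)].
Let tmap (i : chart M) (p : TM) : 'rV[R]_(n + n) :=
  row_mx (cmap i (projT1 p)) (projT2 p i).
Let ttr (i j : chart M) (z : 'rV[R]_(n + n)) : 'rV[R]_(n + n) :=
  row_mx (ctr i j (lsubmx z)) ('D_(rsubmx z) (ctr i j) (lsubmx z)).

Let tdom_cover p : exists i, tdom i p.
Proof. exact: cdom_cover. Qed.

Let tmap_inj i p q : tdom i p -> tdom i q -> tmap i p = tmap i q -> p = q.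
Proof.
case: p q => [x u] [y v]; rewrite /tdom /= => ix iy /eq_row_mx /= [exy euv].
have exy' := cmap_inj ix iy exy; subst y.
by rewrite (tangent_eq ix euv).
Qed.

Let timage i (A : set M) :
  tmap i @` ([set p | A (projT1 p)] `&` tdom i) =
  lsubmx @^-1` (cmap i @` (A `&` cdom i)).
Proof.
apply/seteqP; split=> [z [[x u] [/= Ax ix] <-]|z [x [Ax ix] xz]] /=.
  by exists x => //; rewrite row_mxKl.
have [u ui] := tangent_ex (rsubmx z) ix.
by exists (existT _ x u) => //; rewrite /tmap /= ui xz hsubmxK.
Qed.

Let preopen (U : set 'rV[R]_n) : open U ->
  open ((lsubmx : 'rV[R]_(n + n) -> 'rV[R]_n) @^-1` U).
Proof.
move=> Uo; have /continuousP := @continuous_lsubmx R 1 n n.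
by apply.
Qed.

Let toverlap i j : tmap i @` (tdom i `&` tdom j) =
  lsubmx @^-1` (cmap i @` (cdom i `&` cdom j)).
Proof. by rewrite setIC timage setIC. Qed.

Let toverlap_open i j : open (tmap i @` (tdom i `&` tdom j)).
Proof. by rewrite toverlap; apply: preopen; exact: overlap_open. Qed.

Let ttr_tmap i j p : tdom i p -> tdom j p -> ttr i j (tmap i p) = tmap j p.
Proof.
case: p => x u; rewrite /tdom /= => ix jx.
by rewrite /ttr /tmap /= row_mxKl row_mxKr ctr_cmap // (tcomp_ctr u ix jx).
Qed.

Let ttr_smooth i j : smooth (tmap i @` (tdom i `&` tdom j)) (ttr i j).
Proof.
move=> k; rewrite toverlap; apply: Ck_tangent_map; first exact: overlap_open.
exact: ctr_smooth.
Qed.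

Let tpreimage_open i (O : set 'rV[R]_(n + n)) : open O ->
  atlas_open tdom tmap [set p | tdom i p /\ O (tmap i p)].
Proof.
move=> Oo j; rewrite openE => z [p [[ip Op] jp] <-].
have nO : nbhs (tmap j p) (tmap j @` (tdom j `&` tdom i)).
  by apply: open_nbhs_nbhs; split; [exact: toverlap_open|exists p].
have cO : nbhs (tmap j p) (ttr j i @^-1` O).
  have /(_ (tmap j p)) := Ck_continuous (ttr_smooth j i 0).
  apply; first by exists p.
  by rewrite ttr_tmap //; apply: open_nbhs_nbhs.
rewrite /interior; apply: filterS2 nO cO => w [q [jq iq] <-] /=.
by rewrite ttr_tmap // => Oq; exists q.
Qed.

Let ttopen (A : set M) : atlas_open (@cdom _ _ M) (@cmap _ _ M) A ->
  atlas_open tdom tmap [set p | A (projT1 p)].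
Proof. by move=> Ao i; rewrite timage; apply: preopen. Qed.

Let thausdorff (p q : TM) : p <> q -> exists A B : set TM,
  [/\ atlas_open tdom tmap A, atlas_open tdom tmap B, A p, B q & A `&` B = set0].
Proof.
case: p q => [x u] [y v] pq; have [exy|nxy] := pselect (x = y); last first.
  have [A [B [Ao Bo Ax By AB]]] := manifold_hausdorff nxy.
  exists [set p | A (projT1 p)], [set p | B (projT1 p)].
  split => //; [exact: ttopen|exact: ttopen|].
  rewrite -subset0 => -[z w] [/= Az Bz].
  by have : (A `&` B) z by []; rewrite AB.
subst y; have [i ix] := cdom_cover x.
set p := existT _ x u; set q := existT _ x v.
have npq : tmap i p != tmap i q.
  by apply/eqP => /(@tmap_inj i p q ix ix).
have := @norm_hausdorff R 'rV[R]_(n + n); rewrite open_hausdorff.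
move=> /(_ _ _ npq) [[A B] /= [/set_mem Ap /set_mem Bq] [Ao Bo /eqP AB]].
exists [set r | tdom i r /\ A (tmap i r)], [set r | tdom i r /\ B (tmap i r)].
split => //; [exact: tpreimage_open|exact: tpreimage_open|].
rewrite -subset0 => r [[_ r1] [_ r2]].
by have : (A `&` B) (tmap i r) by []; rewrite AB.
Qed.

Let tsecond_countable : exists C : set (chart M),
  countable C /\ forall p, exists2 i, C i & tdom i p.
Proof.
have [C [cC hC]] := manifold_second_countable M.
by exists C; split => // p; exact: hC.
Qed.

(* The charts of TM are the (cmap i, d (cmap i)). *)
Definition tangent_bundle : manifold R (n + n) :=
  @Manifold R (n + n) {x : M & tangent x} (chart M)
    (fun i => [set p | cdom i (projT1 p)])
    (fun i p => row_mx (cmap i (projT1 p)) (projT2 p i))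
    (fun i j z =>
       row_mx (ctr i j (lsubmx z)) ('D_(rsubmx z) (ctr i j) (lsubmx z)))
    tdom_cover tmap_inj toverlap_open ttr_tmap ttr_smooth thausdorff
    tsecond_countable.

End TangentBundle.

Definition bil (R : realType) (n : nat) (q : 'M[R]_n) (u v : 'rV[R]_n) : R :=
  (u *m q *m v^T) 0 0.

(* A smooth symmetric (0,2)-tensor field, given by its Gram matrices in the
   charts; [tens i] is meaningful only on the image of chart [i]. *)
Record sym_tensor (R : realType) (n : nat) (M : manifold R n) := SymTensor {
  tens :> chart M -> 'rV[R]_n -> 'M[R]_n;
  tens_smooth : forall i a b,
    smooth (cmap i @` cdom i) (fun y => tens i y a b);
  tens_sym : forall i x, cdom i x -> (tens i (cmap i x))^T = tens i (cmap i x);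
  tens_ctr : forall i j x, cdom i x -> cdom j x -> forall u v,
    bil (tens j (cmap j x)) ('D_u (ctr i j) (cmap i x))
      ('D_v (ctr i j) (cmap i x)) = bil (tens i (cmap i x)) u v
}.

Definition nondegenerate_tensor (R : realType) (n : nat) (M : manifold R n)
    (q : sym_tensor M) : Prop :=
  forall i x, cdom i x -> forall u,
    (forall v, bil (q i (cmap i x)) u v = 0) -> u = 0.

Definition riemannian (R : realType) (n : nat) (M : manifold R n)
    (g : sym_tensor M) : Prop :=
  forall i x, cdom i x -> forall u, u != 0 -> 0 < bil (g i (cmap i x)) u u.

(* [q] is the Gram matrix of a metric in a chart, as a function of the
   coordinates; vector fields are given by their components in this chart. *)
Section LeviCivita.
Variables (R : realType) (n : nat).
Implicit Types (q : 'rV[R]_n -> 'M[R]_n) (X Y Z : 'rV[R]_n -> 'rV[R]_n).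

(* The bilinear map whose components are the Christoffel symbols: the solution
   w of the Koszul formula for constant fields,
   2 q(w, e_l) = d_a q(b, e_l) + d_b q(a, e_l) - d_l q(a, b) for all l. *)
Definition christoffel q (y a b : 'rV[R]_n) : 'rV[R]_n :=
  2^-1 *: ((\row_l ('D_a (fun z => bil (q z) b (delta_mx 0 l)) y
                  + 'D_b (fun z => bil (q z) a (delta_mx 0 l)) y
                  - 'D_(delta_mx 0 l) (fun z => bil (q z) a b) y))
           *m invmx (q y)).

Definition nabla q X Y : 'rV[R]_n -> 'rV[R]_n :=
  fun y => 'D_(X y) Y y + christoffel q y (X y) (Y y).

Definition lie_bracket X Y : 'rV[R]_n -> 'rV[R]_n :=
  fun y => 'D_(X y) Y y - 'D_(Y y) X y.

Definition curvature q X Y Z : 'rV[R]_n -> 'rV[R]_n :=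
  fun y => nabla q X (nabla q Y Z) y - nabla q Y (nabla q X Z) y
           - nabla q (lie_bracket X Y) Z y.

(* By tensoriality the extensions of the three vectors can be constant. *)
Definition riemann q (y a b c : 'rV[R]_n) : 'rV[R]_n :=
  curvature q (fun=> a) (fun=> b) (fun=> c) y.

Definition jacobi q (y a b : 'rV[R]_n) : 'rV[R]_n := riemann q y a b a.

(* The spectrum of a real endomorphism is taken in the complex numbers, so that
   an equality of spectra also excludes non-real eigenvalues. *)
Definition spectrum (f : 'rV[R]_n -> 'rV[R]_n) : set R[i] :=
  [set z | eigenvalue (map_mx (real_complex R) (lin1_mx f)) z].

Lemma bilE (q : 'M[R]_n) u v :
  bil q u v = \sum_i \sum_j u 0 i * q i j * v 0 j.
Proof.
rewrite /bil mxE; under eq_bigr do rewrite !mxE mulr_suml.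
by rewrite exchange_big.
Qed.

Lemma bil_trmx (q : 'M[R]_n) u v : bil q^T u v = bil q v u.
Proof.
rewrite !bilE exchange_big; apply: eq_bigr => i _; apply: eq_bigr => j _.
by rewrite mxE; ring.
Qed.

Lemma derive_bil q X Y (y v : 'rV[R]_n) :
  (forall i j, differentiable (fun z => q z i j) y) ->
  differentiable X y -> differentiable Y y ->
  'D_v (fun z => bil (q z) (X z) (Y z)) y =
    bil (\matrix_(i, j) 'D_v (fun z => q z i j) y) (X y) (Y y)
    + bil (q y) ('D_v X y) (Y y) + bil (q y) (X y) ('D_v Y y).
Proof.
move=> dq dX dY.
have DX i : is_derive y v (fun z => X z 0 i) ('D_v X y 0 i).
  have h := diff_derivable (v:=v) dX.
  apply: DeriveDef; first exact: (derivable_mxP X y v).1 h _ _.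
  by rewrite [in RHS]derive_mx // mxE.
have DY i : is_derive y v (fun z => Y z 0 i) ('D_v Y y 0 i).
  have h := diff_derivable (v:=v) dY.
  apply: DeriveDef; first exact: (derivable_mxP Y y v).1 h _ _.
  by rewrite [in RHS]derive_mx // mxE.
have Dq i j : is_derive y v (fun z => q z i j) ('D_v (fun z => q z i j) y).
  by apply: derivableP; exact: diff_derivable.
have -> : (fun z => bil (q z) (X z) (Y z)) = \sum_(i < n) \sum_(j < n)
    ((fun z => X z 0 i) * (fun z => q z i j) * (fun z => Y z 0 j)).
  apply/funext => z; rewrite bilE fct_sumE; apply: eq_bigr => i _.
  by rewrite fct_sumE.
rewrite (@derive_val _ _ _ _ _ _ _ (is_derive_sum (fun i => is_derive_sum (fun j =>
   is_deriveM (is_deriveM (DX i) (Dq i j)) (DY j))))).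
rewrite !bilE -!big_split /=; apply: eq_bigr => i _.
rewrite -!big_split /=; apply: eq_bigr => j _.
rewrite mxE /GRing.scale /= !fctE.
by ring.
Qed.

Section Characterization.
Variables (q : 'rV[R]_n -> 'M[R]_n) (y : 'rV[R]_n).
Hypothesis dq : forall i j, differentiable (fun z => q z i j) y.
Hypothesis sq : \near y, (q y)^T = q y.
Hypothesis uq : q y \in unitmx.

Let D (v : 'rV[R]_n) : 'M[R]_n := \matrix_(i, j) 'D_v (fun z => q z i j) y.

Let DE (v a b : 'rV[R]_n) : 'D_v (fun z => bil (q z) a b) y = bil (D v) a b.
Proof.
have dc (w : 'rV[R]_n) : differentiable (fun=> w) y by exact: differentiable_cst.
rewrite (@derive_bil q (fun=> a) (fun=> b)) // !derive_cst.
have -> : bil (q y) 0 b = 0 by rewrite /bil !mul0mx mxE.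
have -> : bil (q y) a 0 = 0 by rewrite /bil trmx0 mulmx0 mxE.
by rewrite !addr0.
Qed.

Let Dsym (v a b : 'rV[R]_n) : bil (D v) a b = bil (D v) b a.
Proof.
rewrite -!DE; apply: near_eq_derive; apply: filterS sq => z sz.
by rewrite -[in LHS]sz bil_trmx.
Qed.

Let Dlin (v a b : 'rV[R]_n) : \sum_l bil (D (delta_mx 0 l)) a b * v 0 l = bil (D v) a b.
Proof.
have Dij i j : D v i j = \sum_l v 0 l * D (delta_mx 0 l) i j.
  rewrite mxE deriveE // [in LHS](row_sum_delta v) linear_sum.
  by apply: eq_bigr => l _; rewrite linearZ mxE deriveE.
rewrite [RHS]bilE; under [LHS]eq_bigr do rewrite bilE mulr_suml.
rewrite exchange_big; apply: eq_bigr => i _.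
under eq_bigr do rewrite mulr_suml.
rewrite exchange_big; apply: eq_bigr => j _.
rewrite Dij mulr_sumr mulr_suml; apply: eq_bigr => l _; ring.
Qed.

Lemma christoffelC a b : christoffel q y a b = christoffel q y b a.
Proof.
rewrite /christoffel; congr (_ *: (_ *m _)); apply/rowP => l; rewrite !mxE.
by rewrite !DE (Dsym _ a b) [X in X - _]addrC.
Qed.

Lemma koszul a b c : bil (q y) (christoffel q y a b) c =
  2^-1 * (bil (D a) b c + bil (D b) a c - bil (D c) a b).
Proof.
rewrite /bil /christoffel -scalemxAl mulmxKV // -scalemxAl mxE; congr (_ * _).
rewrite mxE -!/(bil _ _ _) -(Dlin c a b) (row_sum_delta c).
have bl (N : 'M[R]_n) u : bil N u c = \sum_l bil N u (delta_mx 0 l) * c 0 l.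
  rewrite /bil {1}(row_sum_delta c) linear_sum mulmx_sumr summxE.
  by apply: eq_bigr => l _; rewrite linearZ -scalemxAr mxE mulrC.
rewrite -(row_sum_delta c) !bl -big_split -sumrB; apply: eq_bigr => l _.
by rewrite !mxE !DE mulrBl mulrDl.
Qed.

Lemma nabla_torsion_free X Y :
  nabla q X Y y - nabla q Y X y = lie_bracket X Y y.
Proof. by rewrite /nabla christoffelC opprD addrACA subrr addr0. Qed.

Lemma nabla_metric X Y Z : differentiable Y y -> differentiable Z y ->
  'D_(X y) (fun z => bil (q z) (Y z) (Z z)) y =
  bil (q y) (nabla q X Y y) (Z y) + bil (q y) (Y y) (nabla q X Z y).
Proof.
move=> dY dZ; rewrite derive_bil // -/(D (X y)).
have bDl u v w : bil (q y) (u + v) w = bil (q y) u w + bil (q y) v w.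
  by rewrite /bil !mulmxDl mxE.
have bDr u v w : bil (q y) u (v + w) = bil (q y) u v + bil (q y) u w.
  by rewrite /bil linearD mulmxDr mxE.
rewrite /nabla bDl bDr koszul.
rewrite -[in X in _ = _ + (_ + X)](nbhs_singleton sq) bil_trmx koszul.
by rewrite (Dsym (X y) (Z y)); lra.
Qed.

End Characterization.

End LeviCivita.

(* In the chart of TM induced by a chart of M, [q] is the Gram matrix of g, the
   point z = (y, u) is the vector u at y, and a tangent vector (a, b) at z is
   horizontal, i.e. tangent to a curve of parallel vectors, when
   b = - christoffel q y a u. *)
Definition hlift (R : realType) (n : nat) (q : 'rV[R]_n -> 'M[R]_n)
    (z : 'rV[R]_(n + n)) (a : 'rV[R]_n) : 'rV[R]_(n + n) :=
  row_mx a (- christoffel q (lsubmx z) a (rsubmx z)).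

Definition vlift (R : realType) (n : nat) (a : 'rV[R]_n) : 'rV[R]_(n + n) :=
  row_mx 0 a.

Definition hfield (R : realType) (n : nat) (q : 'rV[R]_n -> 'M[R]_n)
    (X : 'rV[R]_n -> 'rV[R]_n) (z : 'rV[R]_(n + n)) : 'rV[R]_(n + n) :=
  hlift q z (X (lsubmx z)).

Definition vfield (R : realType) (n : nat)
    (X : 'rV[R]_n -> 'rV[R]_n) (z : 'rV[R]_(n + n)) : 'rV[R]_(n + n) :=
  vlift (X (lsubmx z)).

Record natural_functions (R : realType) := NaturalFunctions {
  alpha1 : R -> R; alpha2 : R -> R; alpha3 : R -> R;
  beta1 : R -> R; beta2 : R -> R; beta3 : R -> R;
  alpha1_smooth : smooth_ge0 alpha1;
  alpha2_smooth : smooth_ge0 alpha2;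
  alpha3_smooth : smooth_ge0 alpha3;
  beta1_smooth : smooth_ge0 beta1;
  beta2_smooth : smooth_ge0 beta2;
  beta3_smooth : smooth_ge0 beta3
}.

Definition is_natural_metric (R : realType) (n : nat) (M : manifold R n)
    (w : natural_functions R) (g : sym_tensor M)
    (G : sym_tensor (tangent_bundle M)) : Prop :=
  forall (i : chart M) (p : tangent_bundle M), cdom i (projT1 p) ->
  forall X Y : 'rV[R]_n,
  let u := projT2 p i in
  let z := @cmap _ _ (tangent_bundle M) i p in
  let gp := bil (g i (cmap i (projT1 p))) in
  let Gp := bil (G i z) in
  let t := gp u u in
  let Xh := hlift (g i) z X in
  let Yh := hlift (g i) z Y in
  [/\ Gp Xh Yh = (alpha1 w t + alpha3 w t) * gp X Y
                 + (beta1 w t + beta3 w t) * gp X u * gp Y u,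
      Gp Xh (vlift Y) = alpha2 w t * gp X Y + beta2 w t * gp X u * gp Y u,
      Gp (vlift X) Yh = alpha2 w t * gp X Y + beta2 w t * gp X u * gp Y u &
      Gp (vlift X) (vlift Y) =
        alpha1 w t * gp X Y + beta1 w t * gp X u * gp Y u].

Definition T_ (R : realType) (n : nat) (q : 'rV[R]_n -> 'M[R]_n) (y : 'rV[R]_n)
    (i : nat) (u X Y : 'rV[R]_n) : 'rV[R]_n :=
  match i with
  | 1 => riemann q y X u Y
  | 2 => riemann q y Y u X
  | 3 => bil (q y) (riemann q y X u Y) u *: u
  | 4 => bil (q y) X u *: Y
  | 5 => bil (q y) Y u *: X
  | 6 => bil (q y) X Y *: u
  | 7 => (bil (q y) X u * bil (q y) Y u) *: u
  | _ => 0
  end.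

Definition T_comb (R : realType) (n : nat) (q : 'rV[R]_n -> 'M[R]_n)
    (y : 'rV[R]_n) (c : nat -> R -> R) (u X Y : 'rV[R]_n) : 'rV[R]_n :=
  \sum_(1 <= i < 8) c i (bil (q y) u u) *: T_ q y i u X Y.

Inductive letter := lA | lB | lC | lD | lE | lF.

(* Vector fields on the domain of a chart suffice: the formulas are local and
   chart domains are themselves Riemannian manifolds. *)
Definition connection_formulas (R : realType) (n : nat) (M : manifold R n)
    (g : sym_tensor M) (G : sym_tensor (tangent_bundle M))
    (f : letter -> nat -> R -> R) : Prop :=
  forall (i : chart M) (X Y : 'rV[R]_n -> 'rV[R]_n),
  smooth (cmap i @` cdom i) X -> smooth (cmap i @` cdom i) Y ->
  forall p : tangent_bundle M, cdom i (projT1 p) ->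
  let y := cmap i (projT1 p) in
  let u := projT2 p i in
  let z := @cmap _ _ (tangent_bundle M) i p in
  let Xh := hfield (g i) X in let Xv := vfield X in
  let Yh := hfield (g i) Y in let Yv := vfield Y in
  let h := hlift (g i) z in let v := @vlift R n in
  let P l a b := T_comb (g i) y (f l) u a b in
  [/\ nabla (G i) Xh Yh z = h (nabla (g i) X Y y)
        + h (P lA (X y) (Y y)) + v (P lB (X y) (Y y)),
      nabla (G i) Xh Yv z = v (nabla (g i) X Y y)
        + h (P lC (X y) (Y y)) + v (P lD (X y) (Y y)),
      nabla (G i) Xv Yh z = h (P lC (Y y) (X y)) + v (P lD (Y y) (X y)) &
      nabla (G i) Xv Yv z = h (P lE (Y y) (X y)) + v (P lF (Y y) (X y))].

(* The functions f_i^P, for 1 <= i <= 7, attached to [w]; the values of [f] at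
   other indices are irrelevant. *)
Definition connection_coefficients (R : realType) (w : natural_functions R)
    (f : letter -> nat -> R -> R) : Prop :=
  (forall l i, (1 <= i <= 7)%N -> smooth_ge0 (f l i)) /\
  forall (n : nat) (M : manifold R n) (g : sym_tensor M)
    (G : sym_tensor (tangent_bundle M)), (2 <= n)%N ->
    riemannian g -> is_natural_metric w g G -> nondegenerate_tensor G ->
    connection_formulas g G f.

(* X |-> X *m J is the rotation by pi/2 for one of the two orientations of the
   Euclidean plane (R^2, q). *)
Definition quarter_turn (R : realType) (q : 'M[R]_2) (J : 'M[R]_2) : Prop :=
  forall X : 'rV[R]_2,
    bil q (X *m J) (X *m J) = bil q X X /\ bil q (X *m J) X = 0.

Definition is_curvature_function (R : realType) (M : manifold R 2)
    (g : sym_tensor M) (k : M -> R) : Prop :=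
  forall (x : M) (i : chart M), cdom i x ->
  forall J, quarter_turn (g i (cmap i x)) J ->
  forall X Y Z : 'rV[R]_2,
    riemann (g i) (cmap i x) X Y Z =
    (k x * bil (g i (cmap i x)) (X *m J) Y) *: (Z *m J).

(* Main.v *)
Require Import Defs.
From HB Require Import structures.
From mathcomp Require Import all_boot all_order all_algebra.
From mathcomp Require Import all_classical all_reals all_analysis.
From mathcomp Require Import perm complex ring.

Set Implicit Arguments.
Unset Strict Implicit.
Unset Printing Implicit Defensive.

Import Order.TTheory GRing.Theory Num.Theory.
Import numFieldNormedType.Exports.

Local Open Scope classical_set_scope.
Local Open Scope ring_scope.

(** Let (y, u) be the coordinates of the tangent bundle induced by a chart of the
    surface, and work at the zero section u = 0.  There a horizontal lift is
    (X, 0), a vertical lift is (0, X), and the connection formulas show that the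
    Levi-Civita connection of G restricts to the one of g on both factors, all
    correction terms being homogeneous of positive degree in u.  The curvature
    R(X, Y)X of the bundle, for X = H^h, contains only one derivative
    transversal to the zero section, and two cases arise.

    For Y = Z^h everything takes place inside the zero section, which is totally
    geodesic, and the Jacobi operator is that of the base:
    J(Z^h) = (R(H, Z)H)^h ([jacobi_horizontal]).

    For Y = Z^v the transversal derivative is that of the covariant derivative
    of H^h along itself, equal to (nabla_H H)^h + h{A(u; H, H)} + v{B(u; H, H)},
    and J(Z^v) is minus the differential at u = 0 of the last two terms, in the
    direction Z ([jacobi_vertical]).  The terms T^3 and T^7 are cubic in u and
    do not contribute; the others give
    f_1 R(H, Z)H + f_2 R(H, Z)H + (f_4 + f_5) g(H, Z)H + f_6 g(H, H)Z at 0.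

    In dimension two R(H, Z)H = k g(iH, Z) iH, and a g(H, H) = 1 where
    a = (alpha_1 + alpha_3)(0).  Hence in the basis H^h, (iH)^h, H^v, (iH)^v the
    operator is triangular, with diagonal entries 0, k / a,
    - (f_4 + f_5 + f_6)(0) / a and - (f_6 + k (f_1 + f_2))(0) / a, the f_i being
    those of B; a triangular matrix has its diagonal as spectrum
    ([spectrum_trig]).

    The computation is carried out with constant fields in the chart, whose
    covariant derivatives are values of the Christoffel map; its differentials
    at the zero section are taken along lines ([derive_along_line]). *)

(** * Directional derivatives and smooth matrix functions *)

Section Calculus.
Variable R : realType.
Implicit Types V W : normedModType R.

Lemma row_linear_continuous n V (L : 'rV[R]_n -> V) : linear L -> continuous L.
Proof.
move=> hL.
pose L' : {linear 'rV[R]_n -> V} := HB.pack L (GRing.isLinear.Build _ _ _ _ _ hL).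
have -> : L = fun u => \sum_(j < n) u 0 j *: L (delta_mx 0 j).
  apply/funext => u; rewrite {1}(row_sum_delta u) -[L]/(L' : _ -> _) linear_sum.
  by apply: eq_bigr => j _; rewrite linearZ.
have : Ck 0 setT (fun u : 'rV[R]_n => \sum_(j < n) u 0 j *: L (delta_mx 0 j)).
  apply: Ck_sum; first exact: openT.
  move=> j u _; apply: (@continuous_comp _ _ _ (coord_lin R j)
    (fun c : R => c *: L (delta_mx 0 j))).
    exact: coord_lin_continuous.
  exact: scalel_continuous.
by move=> cL u; exact: cL.
Qed.

Lemma cvg_row_linear n V (T : Type) (F : set_system T) (p : T -> 'rV[R]_n) a
    (L : 'rV[R]_n -> V) : linear L -> p @ F --> a -> L (p t) @[t --> F] --> L a.
Proof.
by move=> lL pa; apply: (cvg_comp _ _ pa); exact: row_linear_continuous.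
Qed.

Lemma cvg_row_mx m n (T : Type) (F : set_system T) (FF : Filter F)
    (p : T -> 'rV[R]_m) (q : T -> 'rV[R]_n) a b :
  p @ F --> a -> q @ F --> b ->
  (row_mx (p t) (q t) : 'rV[R]_(m + n)) @[t --> F] --> (row_mx a b : 'rV[R]_(m + n)).
Proof.
move=> pa qb.
have ll : linear (fun w : 'rV[R]_m => row_mx w (0 : 'rV[R]_n)).
  by move=> s u v; rewrite scale_row_mx add_row_mx scaler0 addr0.
have lr : linear (fun w : 'rV[R]_n => row_mx (0 : 'rV[R]_m) w).
  by move=> s u v; rewrite scale_row_mx add_row_mx scaler0 addr0.
have E (u : 'rV[R]_m) (v : 'rV[R]_n) : row_mx u v = row_mx u 0 + row_mx 0 v.
  by rewrite add_row_mx addr0 add0r.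
rewrite E (_ : (fun t => _) = fun t => row_mx (p t) 0 + row_mx 0 (q t)); last first.
  by apply/funext => t; rewrite E.
by apply: cvgD; [exact: (cvg_row_linear ll)|exact: (cvg_row_linear lr)].
Qed.

(** A derivative is a limit along one line, so it can be read off an expansion
    of [F] on that line: a linear image of the increment of a function [f] whose
    derivative is known, plus [h] times something convergent.  This trades the
    differentiation of composite expressions in the coordinates (y, u) of the
    tangent bundle for exact algebra at the points of a line. *)
Lemma derive_along_line V V' W n (F : V -> W) (f : V' -> 'rV[R]_n)
    (L : 'rV[R]_n -> W) (x v : V) (y a : V') (phi : R -> W) (l : W) :
  linear L -> derivable f y a ->
  (\forall h \near 0^', F (h *: v + x) - F x =
     L (f (h *: a + y) - f y) + h *: phi h) ->
  phi @ 0^' --> l -> 'D_v F x = L ('D_a f y) + l.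
Proof.
move=> hL df FE phil.
pose L' : {linear 'rV[R]_n -> W} := HB.pack L (GRing.isLinear.Build _ _ _ _ _ hL).
apply/cvg_lim => //.
have cL : L (h^-1 *: ((f \o shift y) (h *: a) - f y)) @[h --> 0^'] --> L ('D_a f y).
  exact: (cvg_row_linear hL df).
apply: cvg_trans (cvgD cL phil); apply: near_eq_cvg; near=> h.
have h0 : h != 0 by near: h; exact: nbhs_dnbhs_neq.
have -> : (F \o shift x) (h *: v) - F x = L (f (h *: a + y) - f y) + h *: phi h.
  by near: h.
rewrite scalerDr scalerA mulVf // scale1r -[L]/(L' : _ -> _) -linearZ.
by [].
Unshelve. all: by end_near. Qed.

Lemma derive_quotient_cvg V W (F : V -> W) (x v : V) (phi : R -> W) (l : W) :
  (\forall h \near 0^', F (h *: v + x) - F x = h *: phi h) ->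
  phi @ 0^' --> l -> 'D_v F x = l.
Proof.
move=> FE phil; apply/cvg_lim => //.
apply: cvg_trans phil; apply: near_eq_cvg; near=> h.
have h0 : h != 0 by near: h; exact: nbhs_dnbhs_neq.
have -> : (F \o shift x) (h *: v) - F x = h *: phi h by near: h.
by rewrite scalerA mulVf // scale1r.
Unshelve. all: by end_near. Qed.

Lemma cvg_line V (x v : V) : h *: v + x @[h --> (0 : R)^'] --> x.
Proof.
rewrite -[X in _ --> X]add0r -(scale0r v).
apply: cvgD; last exact: cvg_cst.
by apply: cvgZr_tmp; apply: cvg_within_filter; exact: cvg_id.
Qed.

Lemma cvg_along_line V W (f : V -> W) (x v : V) : {for x, continuous f} ->
  f (h *: v + x) @[h --> (0 : R)^'] --> f x.
Proof. by move=> cf; apply: (cvg_comp _ _ (@cvg_line V x v)); exact: cf. Qed.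

Lemma near_line V (U : set V) (x v : V) : open U -> U x ->
  \forall h \near (0 : R)^', U (h *: v + x).
Proof. by move=> Uo Ux; apply: (@cvg_line V x v); exact: open_nbhs_nbhs. Qed.

Lemma differentiable_row n V (f : V -> 'rV[R]_n) x :
  (forall j, differentiable (fun y => f y 0 j) x) -> differentiable f x.
Proof.
move=> df.
have -> : f = \sum_(j < n) (fun y => f y 0 j *: (delta_mx 0 j : 'rV[R]_n)).
  by apply/funext => y; rewrite fct_sumE; exact: row_sum_delta.
by apply: differentiable_sum => j; exact: differentiableZl.
Qed.

Lemma differentiable_prod n V (f : 'I_n -> V -> R) x :
  (forall i, differentiable (f i) x) ->
  differentiable (fun y => \prod_(i < n) f i y) x.
Proof.
elim: n f => [|n IH] f df.
  by under eq_fun do rewrite big_ord0; exact: differentiable_cst.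
under eq_fun do rewrite big_ord_recr.
by apply: differentiableM => //; exact: (IH (fun i => f (widen_ord _ i))).
Qed.

Lemma differentiable_det n V (A : V -> 'M[R]_n) x :
  (forall i j, differentiable (fun y => A y i j) x) ->
  differentiable (fun y => \det (A y)) x.
Proof.
move=> dA; rewrite /determinant.
have : forall s : 'S_n, differentiable
    (fun y => (-1) ^+ s * \prod_(i < n) A y i (s i)) x.
  move=> s; apply: differentiableM; first exact: differentiable_cst.
  by apply: differentiable_prod => i.
move=> h.
rewrite (_ : (fun y => _) =
  \sum_(s : 'S_n) (fun y => (-1) ^+ s * \prod_(i < n) A y i (s i))); last first.
  by apply/funext => y; rewrite fct_sumE.
by elim/big_ind : _ => // ? ? g1 g2; exact: differentiableD.
Qed.

(** Cramer's rule: near [x] the entries of the inverse are quotients of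
    polynomials in the entries of the matrix. *)
Lemma differentiable_invmx n V (A : V -> 'M[R]_n) (U : set V) x i j :
  open U -> U x -> (forall y, U y -> A y \in unitmx) ->
  (forall i j, differentiable (fun y => A y i j) x) ->
  differentiable (fun y => invmx (A y) i j) x.
Proof.
move=> Uo Ux uA dA.
pose f y := (\det (A y))^-1 * ((-1) ^+ (j + i) * \det (row' j (col' i (A y)))).
apply: (@near_eq_differentiable _ _ _ f).
  have : \forall y \near x, U y by exact: open_nbhs_nbhs.
  by apply: filterS => y Uy; rewrite /invmx uA // !mxE.
apply: differentiableM.
  apply: differentiableV; first exact: differentiable_det.
  by have := uA _ Ux; rewrite unitmxE unitfE.
apply: differentiableM; first exact: differentiable_cst.
apply: differentiable_det => a b.
by under eq_fun do rewrite !mxE; exact: dA.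
Qed.

End Calculus.

(** * Christoffel map and curvature in a chart *)

Section Christoffel.
Variables (R : realType) (n : nat).
Implicit Types (q : 'rV[R]_n -> 'M[R]_n) (U : set 'rV[R]_n).

Lemma bil_linearl (N : 'M[R]_n) s u v w :
  bil N (s *: u + v) w = s * bil N u w + bil N v w.
Proof. by rewrite /bil !mulmxDl -!scalemxAl !mxE. Qed.

Lemma bil_linearr (N : 'M[R]_n) s u v w :
  bil N w (s *: u + v) = s * bil N w u + bil N w v.
Proof. by rewrite /bil linearP /= mulmxDr -scalemxAr !mxE. Qed.

Lemma bilZl (N : 'M[R]_n) s u w : bil N (s *: u) w = s * bil N u w.
Proof. by rewrite /bil -!scalemxAl !mxE. Qed.

Lemma bilZr (N : 'M[R]_n) s u w : bil N w (s *: u) = s * bil N w u.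
Proof. by rewrite /bil linearZ /= -scalemxAr !mxE. Qed.

Lemma smooth_bil q U b c : open U ->
  (forall i j, smooth U (fun y => q y i j)) ->
  smooth U (fun y => bil (q y) b c).
Proof.
move=> Uo sq k; rewrite (_ : (fun y => _) = fun y =>
  \sum_i \sum_j (b 0 i * c 0 j) *: (q y i j : R)); last first.
  apply/funext => y; rewrite bilE; apply: eq_bigr => i _; apply: eq_bigr => j _.
  by rewrite mulrAC.
by do 2![apply: Ck_sum => // ?]; apply: CkZ => //; exact: sq.
Qed.

Section Pointwise.
Variables (q : 'rV[R]_n -> 'M[R]_n) (y : 'rV[R]_n).
Hypothesis dq : forall b c, differentiable (fun z => bil (q z) b c) y.

Let d v b c : R := 'D_v (fun z => bil (q z) b c) y.

Let d1 s u v b c : d (s *: u + v) b c = s * d u b c + d v b c.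
Proof. by rewrite /d !deriveE // linearP. Qed.

Let d2 s u v a c : d a (s *: u + v) c = s * d a u c + d a v c.
Proof.
rewrite /d; under eq_fun do rewrite bil_linearl.
have du := diff_derivable (v := a) (dq u c).
have dv := diff_derivable (v := a) (dq v c).
rewrite (deriveD (derivableZ (k := s) du) dv).
by congr (_ + _); exact: deriveZ.
Qed.

Let d3 s u v a b : d a b (s *: u + v) = s * d a b u + d a b v.
Proof.
rewrite /d; under eq_fun do rewrite bil_linearr.
have du := diff_derivable (v := a) (dq b u).
have dv := diff_derivable (v := a) (dq b v).
rewrite (deriveD (derivableZ (k := s) du) dv).
by congr (_ + _); exact: deriveZ.
Qed.

Let koszul_rearrange (s A B C A' B' C' : R) :
  (s * A + A') + (s * B + B') - (s * C + C') = s * (A + B - C) + (A' + B' - C').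
Proof. by ring. Qed.

Lemma christoffel_linearl b : linear (fun a => christoffel q y a b).
Proof.
move=> s u v; rewrite /christoffel scalerA mulrC -scalerA -scalerDr.
congr (_ *: _); rewrite scalemxAl -mulmxDl; congr (_ *m _).
apply/rowP => l; have := d1 s u v b (delta_mx 0 l); have := d2 s u v b (delta_mx 0 l).
have := d2 s u v (delta_mx 0 l) b; rewrite /d => E1 E2 E3.
by rewrite !mxE E1 E2 E3 koszul_rearrange.
Qed.

Lemma christoffel_linearr a : linear (fun b => christoffel q y a b).
Proof.
move=> s u v; rewrite /christoffel scalerA mulrC -scalerA -scalerDr.
congr (_ *: _); rewrite scalemxAl -mulmxDl; congr (_ *m _).
apply/rowP => l; have := d1 s u v a (delta_mx 0 l); have := d2 s u v a (delta_mx 0 l).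
have := d3 s u v (delta_mx 0 l) a; rewrite /d => E1 E2 E3.
by rewrite !mxE E1 E2 E3 koszul_rearrange.
Qed.

Lemma christoffelZl s a b :
  christoffel q y (s *: a) b = s *: christoffel q y a b.
Proof. exact: (scalable_linear (christoffel_linearl b)). Qed.

Lemma christoffelZr s a b :
  christoffel q y a (s *: b) = s *: christoffel q y a b.
Proof. exact: (scalable_linear (christoffel_linearr a)). Qed.

Lemma christoffelDl a a' b :
  christoffel q y (a + a') b = christoffel q y a b + christoffel q y a' b.
Proof. by have := christoffel_linearl b 1 a a'; rewrite /= !scale1r. Qed.

Lemma christoffelDr a b b' :
  christoffel q y a (b + b') = christoffel q y a b + christoffel q y a b'.
Proof. by have := christoffel_linearr a 1 b b'; rewrite /= !scale1r. Qed.

Lemma christoffel0l b : christoffel q y 0 b = 0.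
Proof. by rewrite -[X in christoffel q y X _](scale0r (0 : 'rV[R]_n)) christoffelZl scale0r. Qed.

Lemma christoffel0r a : christoffel q y a 0 = 0.
Proof. by rewrite -[X in christoffel q y _ X](scale0r (0 : 'rV[R]_n)) christoffelZr scale0r. Qed.

Lemma christoffelNr a b : christoffel q y a (- b) = - christoffel q y a b.
Proof. by rewrite -scaleN1r christoffelZr scaleN1r. Qed.

(** The classical coordinate formula: constant fields commute, so the bracket
    term of the curvature disappears. *)
Lemma riemannE a b c : riemann q y a b c =
  'D_a (fun z => christoffel q z b c) y - 'D_b (fun z => christoffel q z a c) y
  + christoffel q y a (christoffel q y b c)
  - christoffel q y b (christoffel q y a c).
Proof.
have nc u v : nabla q (fun=> u) (fun=> v) = fun z => christoffel q z u v.
  by apply/funext => z; rewrite /nabla (derive_cst v) add0r.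
have lb : lie_bracket (fun=> a) (fun=> b) y = 0.
  by rewrite /lie_bracket (derive_cst a) (derive_cst b) subrr.
have n0 : nabla q (lie_bracket (fun=> a) (fun=> b)) (fun=> c) y = 0.
  by rewrite {1}/nabla lb (derive_cst c) christoffel0l addr0.
rewrite /riemann /curvature n0 subr0 (nc b c) (nc a c) {1 2}/nabla.
by rewrite opprD addrACA addrA.
Qed.

End Pointwise.

Lemma differentiable_christoffel q U y a b : open U -> U y ->
  (forall i j, smooth U (fun y => q y i j)) ->
  (forall z, U z -> q z \in unitmx) ->
  differentiable (fun z => christoffel q z a b) y.
Proof.
move=> Uo Uy sq uq.
have dD v u w : differentiable (fun z => 'D_v (fun z => bil (q z) u w) z : R) y.
  have [_ /(_ v) [+ _]] := smooth_bil u w Uo sq 2%N.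
  by apply.
apply: differentiableZ; apply: differentiable_row => j.
under eq_fun do rewrite mxE.
rewrite (_ : (fun z => _) = \sum_(l < n) (fun z =>
  ('D_a (fun z => bil (q z) b (delta_mx 0 l)) z
                  + 'D_b (fun z => bil (q z) a (delta_mx 0 l)) z
                  - 'D_(delta_mx 0 l) (fun z => bil (q z) a b) z)
    * invmx (q z) l j)); last first.
  by apply/funext => z; rewrite fct_sumE; apply: eq_bigr => l _; rewrite mxE.
apply: differentiable_sum => l; apply: differentiableM.
  by apply: differentiableB => //; apply: differentiableD.
apply: (differentiable_invmx (U := U)) => // i k.
by have [+ _] := sq i k 1%N; apply.
Qed.

End Christoffel.

(** * The tensors T^i to first order at the zero vector *)

Section FirstOrder.
Variables (R : realType) (n : nat) (q : 'rV[R]_n -> 'M[R]_n).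
Variables (U : set 'rV[R]_n) (y : 'rV[R]_n).
Hypothesis Uo : open U.
Hypothesis Uy : U y.
Hypothesis sq : forall i j, smooth U (fun z => q z i j).
Hypothesis uq : forall z, U z -> q z \in unitmx.

Lemma differentiable_bil z b c : U z -> differentiable (fun z => bil (q z) b c) z.
Proof. by move=> Uz; have [+ _] := smooth_bil b c Uo sq 1%N; apply. Qed.

Let linear_combination_rearrange (s : R) (d1 d2 d3 d4 d5 d6 d7 d8 : 'rV[R]_n) :
  s *: d1 + d2 - (s *: d3 + d4) + (s *: d5 + d6) - (s *: d7 + d8) =
  s *: (d1 - d3 + d5 - d7) + (d2 - d4 + d6 - d8).
Proof. by apply/rowP => j; rewrite !mxE; ring. Qed.

(** Linearity in the second argument serves twice: it makes T^1 and T^2 linear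
    in u, and the Jacobi operator a matrix. *)
Lemma riemann_linear a c : linear (fun b => riemann q y a b c).
Proof.
move=> s u v.
have dq := fun u v => differentiable_bil u v Uy.
have dG u v := differentiable_christoffel u v Uo Uy sq uq.
rewrite !riemannE // !(christoffel_linearl dq _ s u v).
rewrite (christoffel_linearr dq a s).
have E1 : 'D_(s *: u + v) (fun z => christoffel q z a c) y =
    s *: 'D_u (fun z => christoffel q z a c) y
    + 'D_v (fun z => christoffel q z a c) y.
  by rewrite !(deriveE _ (dG a c)) linearP.
have E2 : 'D_a (fun z => christoffel q z (s *: u + v) c) y =
    s *: 'D_a (fun z => christoffel q z u c) y
    + 'D_a (fun z => christoffel q z v c) y.
  have du := diff_derivable (v := a) (dG u c).
  have dv := diff_derivable (v := a) (dG v c).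
  rewrite -(deriveZ s du) -(deriveD (derivableZ (k := s) du) dv).
  apply: near_eq_derive; have : \forall z \near y, U z by exact: open_nbhs_nbhs.
  apply: filterS => z Uz; apply: christoffel_linearl => b d.
  exact: differentiable_bil.
rewrite [X in X - _ + _ - _ = _]E2 [X in _ - X + _ - _ = _]E1.
exact: linear_combination_rearrange.
Qed.

Lemma riemannZ a s b c :
  riemann q y a (s *: b) c = s *: riemann q y a b c.
Proof. exact: (scalable_linear (riemann_linear a c)). Qed.

(** The differential at u = 0 of u |-> P(u; a, b): the terms T^3 and T^7 are
    cubic in u, and the coefficients enter only through their values at 0. *)
Definition T_lin (c : nat -> R -> R) (u a b : 'rV[R]_n) : 'rV[R]_n :=
  c 1%N 0 *: riemann q y a u b + c 2%N 0 *: riemann q y b u a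
  + (c 4%N 0 * bil (q y) a u) *: b + (c 5%N 0 * bil (q y) b u) *: a
  + (c 6%N 0 * bil (q y) a b) *: u.

(** The coefficients are evaluated at g(hu, hu) = h^2 g(u, u); nonnegativity of
   this argument is what allows passing to the smooth extension. *)
Lemma smooth_ge0_cvg (F : R -> R) (r : R) : smooth_ge0 F -> 0 <= r ->
  F (h ^+ 2 * r) @[h --> 0^'] --> F 0.
Proof.
move=> [F' sF FE] r0; rewrite -FE //.
rewrite (_ : (fun h => _) = fun h => F' (h ^+ 2 * r)); last first.
  by apply/funext => h; rewrite FE // mulr_ge0 // sqr_ge0.
have cF : {for 0, continuous F'} by apply: (sF 0%N).
apply: (@cvg_comp _ _ _ _ F' _ (nbhs (0 : R))); last exact: cF.
have : (fun h : R => h ^+ 2 * r) @ (0 : R) --> (0 : R) ^+ 2 * r.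
  by apply: cvgMr_tmp; exact: exprn_continuous.
by rewrite expr0n mul0r; exact: cvg_within_filter.
Qed.

(** Every T^i is homogeneous of degree 1 or 3 in u, so h can be factored out
    exactly, and the quotient [S h] converges by continuity of the coefficients
    at 0. *)
Lemma T_comb_first_order (c : nat -> R -> R) (u a b : 'rV[R]_n) :
  0 <= bil (q y) u u ->
  (forall i, (1 <= i <= 7)%N -> smooth_ge0 (c i)) ->
  exists S : R -> 'rV[R]_n,
    (forall h, T_comb q y c (h *: u) a b = h *: S h) /\
    S @ 0^' --> T_lin c u a b.
Proof.
move=> u0 sc; set t := bil (q y) u u in u0 *.
exists (fun h =>
  c 1%N (h ^+ 2 * t) *: riemann q y a u b + c 2%N (h ^+ 2 * t) *: riemann q y b u a
  + (c 4%N (h ^+ 2 * t) * bil (q y) a u) *: b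
  + (c 5%N (h ^+ 2 * t) * bil (q y) b u) *: a
  + (c 6%N (h ^+ 2 * t) * bil (q y) a b) *: u
  + h *: (h *: ((c 3%N (h ^+ 2 * t) * bil (q y) (riemann q y a u b) u) *: u
     + (c 7%N (h ^+ 2 * t) * bil (q y) a u * bil (q y) b u) *: u))).
split=> [h|].
  rewrite /T_comb unlock /= /T_ !riemannZ !bilZl !bilZr mulrA -expr2 -/t.
  rewrite addr0 /bil /=.
  move: (riemann q y a u b) (riemann q y b u a) => r1 r2.
  rewrite -!/(bil _ _ _).
  move: (bil (q y) r1 u) (bil (q y) a u) (bil (q y) b u) (bil (q y) a b) => b1 b2 b3 b4.
  move: (c 1%N _) (c 2%N _) (c 3%N _) (c 4%N _) (c 5%N _) (c 6%N _) (c 7%N _).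
  move=> c1 c2 c3 c4 c5 c6 c7.
  apply/rowP => j; rewrite !mxE; ring.
have E i : (1 <= i <= 7)%N -> c i (h ^+ 2 * t) @[h --> 0^'] --> c i 0.
  by move=> hi; apply: smooth_ge0_cvg => //; exact: sc.
have idc : h @[h --> (0 : R)^'] --> (0 : R) by apply: cvg_within; exact: cvg_id.
have E1 i r v : (1 <= i <= 7)%N ->
    (c i (h ^+ 2 * t) * r) *: (v : 'rV[R]_n) @[h --> 0^'] --> (c i 0 * r) *: v.
  by move=> hi; apply: cvgZr_tmp; apply: cvgMr_tmp; exact: E.
have E2 i v : (1 <= i <= 7)%N ->
    c i (h ^+ 2 * t) *: (v : 'rV[R]_n) @[h --> 0^'] --> c i 0 *: v.
  by move=> hi; apply: cvgZr_tmp; exact: E.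
have E3 v : (c 7%N (h ^+ 2 * t) * bil (q y) a u * bil (q y) b u) *: (v : 'rV[R]_n)
    @[h --> 0^'] --> (c 7%N 0 * bil (q y) a u * bil (q y) b u) *: v.
  by apply: cvgZr_tmp; do 2!apply: cvgMr_tmp; exact: E.
have lo := cvgD (cvgD (cvgD (cvgD (E2 1%N (riemann q y a u b) isT)
  (E2 2%N (riemann q y b u a) isT)) (E1 4%N (bil (q y) a u) b isT))
  (E1 5%N (bil (q y) b u) a isT)) (E1 6%N (bil (q y) a b) u isT).
have hi := cvgZ idc (cvgZ idc (cvgD
  (E1 3%N (bil (q y) (riemann q y a u b) u) u isT) (E3 u))).
have FF : Filter (0 : R)^' by exact: dnbhs_filter.
have /(_ FF) := cvgD (lo FF FF FF FF) (hi FF FF FF).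
by rewrite scale0r addr0.
Qed.

End FirstOrder.

(** * The connection of the tangent bundle near the zero section *)

Lemma nondegenerate_unitmx (R : realType) n (N : manifold R n)
    (h : sym_tensor N) (l : chart N) (p : N) :
  nondegenerate_tensor h -> cdom l p -> h l (cmap l p) \in unitmx.
Proof.
move=> nd lp; rewrite -row_free_unit -kermx_eq0.
apply/eqP/row_matrixP => j; rewrite row0; apply: (nd l p lp) => u.
by rewrite /bil -row_mul mulmx_ker row0 mul0mx mxE.
Qed.

Lemma riemannian_nondegenerate (R : realType) n (N : manifold R n)
    (h : sym_tensor N) : riemannian h -> nondegenerate_tensor h.
Proof.
move=> hh l p lp u hu; apply/eqP; apply: contraT => u0.
by have := hh _ _ lp _ u0; rewrite hu ltxx.
Qed.

Lemma chart_image_open (R : realType) n (N : manifold R n) (l : chart N) :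
  open (cmap l @` cdom l).
Proof. by have := @overlap_open _ _ N l l; rewrite setIid. Qed.

Lemma jacobi_linear (R : realType) n (N : manifold R n) (h : sym_tensor N)
    (l : chart N) (p : N) v :
  nondegenerate_tensor h -> cdom l p -> linear (jacobi (h l) (cmap l p) v).
Proof.
move=> nd lp; have lU : (cmap l @` cdom l) (cmap l p) by exists p.
apply: (riemann_linear (@chart_image_open _ _ N l) lU (@tens_smooth _ _ _ h l)).
by move=> _ [p' lp' <-]; exact: nondegenerate_unitmx.
Qed.

Section TangentChart.
Variables (R : realType) (n : nat) (M : manifold R n) (g : sym_tensor M).
Variables (G : sym_tensor (tangent_bundle M)) (f : letter -> nat -> R -> R).
Variable i : chart M.
Hypothesis hg : riemannian g.
Hypothesis sf : forall l j, (1 <= j <= 7)%N -> smooth_ge0 (f l j).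
Hypothesis hC : connection_formulas g G f.

Let U : set 'rV[R]_n := cmap i @` cdom i.
Let Ga := christoffel (g i).
Let GaT := christoffel (G i).

Let Uo : open U := @chart_image_open _ _ M i.

Let ug y : U y -> g i y \in unitmx.
Proof.
by move=> [x ix <-]; apply: nondegenerate_unitmx => //; exact: riemannian_nondegenerate.
Qed.

Let sg := @tens_smooth _ _ _ g i.

Lemma riemannian_ge0 y u : U y -> 0 <= bil (g i y) u u.
Proof.
move=> [x ix <-]; have [->|u0] := eqVneq u 0; last exact/ltW/hg.
by rewrite /bil trmx0 mulmx0 mxE.
Qed.

Let dg y b c : U y -> differentiable (fun z => bil (g i z) b c) y.
Proof. by move=> Uy; apply: (differentiable_bil Uo sg). Qed.

Let dGa y a b : U y -> differentiable (fun z => Ga z a b) y.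
Proof. by move=> Uy; apply: (differentiable_christoffel a b Uo Uy sg ug). Qed.

Lemma tangent_bundle_point y u : U y ->
  exists p : tangent_bundle M, [/\ cdom i (projT1 p),
    cmap i (projT1 p) = y & projT2 p i = u].
Proof.
move=> [x ix <-]; have [v vu] := tangent_ex u ix.
by exists (existT _ x v).
Qed.

Let dGT y u b c : U y ->
  differentiable (fun z => bil (G i z) b c) (row_mx y u).
Proof.
move=> Uy; have [p [ip py pu]] := tangent_bundle_point u Uy.
apply: (differentiable_bil (@chart_image_open _ _ (tangent_bundle M) i) (@tens_smooth _ _ _ G i)).
by exists p => //; rewrite /= py pu.
Qed.

Lemma hliftE y u a : hlift (g i) (row_mx y u) a = row_mx a (- Ga y a u).
Proof. by rewrite /hlift row_mxKl row_mxKr. Qed.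

(** The vertical part of the lift is bilinear in the coefficient and the
    vector u, so the derivative obeys a product rule; the second summand is the
    increment of u along the line. *)
Lemma derive_hlift y u a b c : U y ->
  'D_(row_mx a c) (fun z => hlift (g i) z b) (row_mx y u) =
  row_mx 0 (- ('D_a (fun z => Ga z b u) y + Ga y b c)).
Proof.
move=> Uy.
pose L (w : 'rV[R]_n) : 'rV[R]_(n + n) := row_mx 0 (- w).
have lL : linear L.
  move=> s w v; rewrite /L scale_row_mx add_row_mx scaler0 addr0.
  by rewrite scalerN -opprD.
have -> : row_mx 0 (- ('D_a (fun z => Ga z b u) y + Ga y b c)) =
    L ('D_a (fun z => Ga z b u) y) + L (Ga y b c).
  by rewrite /L add_row_mx addr0 -opprD.
have ln := near_line a Uo Uy.
apply: (@derive_along_line _ _ _ _ _ _ _ L _ _ _ _ (fun h => L (Ga (h *: a + y) b c)) _ lL).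
- exact: diff_derivable (dGa b u Uy).
- apply: filterS ln => h Uh.
  rewrite scale_row_mx add_row_mx !hliftE /Ga christoffelDr; last first.
    by move=> p q; exact: dg.
  rewrite christoffelZr; last by move=> p q; exact: dg.
  rewrite /L scale_row_mx opp_row_mx !add_row_mx subrr scaler0 addr0.
  congr row_mx.
  move: (christoffel _ (h *: a + y) b u) (christoffel _ (h *: a + y) b c) => p q.
  by move: (christoffel _ y b u) => r; apply/rowP => k; rewrite !mxE; ring.
apply: (cvg_row_linear lL).
exact: (cvg_along_line a (differentiable_continuous (dGa b c Uy))).
Qed.

Let hl y u w : 'rV[R]_(n + n) := hlift (g i) (row_mx y u) w.
Let P l y u a b := T_comb (g i) y (f l) u a b.

Let nabla_cst y (a b : 'rV[R]_n) :
  nabla (g i) (fun=> a) (fun=> b) y = Ga y a b.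
Proof. by rewrite /nabla (derive_cst b) add0r. Qed.

(** In the next four lemmas the connection formulas, taken for the lifts of
    constant fields, are solved for the Christoffel map of the tangent bundle:
    lifts span every tangent space of the bundle, hence these four values
    determine it.  Only the horizontal lifts have components that vary with
    the point, and their derivative is the correction term. *)
Lemma christoffel_hh y u a b : U y ->
  GaT (row_mx y u) (hl y u a) (hl y u b) =
    hl y u (Ga y a b) + (hl y u (P lA y u a b) + vlift (P lB y u a b))
    + row_mx 0 ('D_a (fun z => Ga z b u) y - Ga y b (Ga y a u)).
Proof.
move=> Uy; have [p [ip py pu]] := tangent_bundle_point u Uy.
have [+ _ _ _] := hC (fun k => Ck_cst k _ a) (fun k => Ck_cst k _ b) ip.
rewrite /= py pu nabla_cst /nabla.
rewrite -[hfield (g i) (fun=> b)]/(fun z => hlift (g i) z b).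
rewrite -[hfield (g i) (fun=> a) _]/(hl y u a).
rewrite {1}/hl hliftE derive_hlift // => E.
rewrite -[LHS](addKr (row_mx 0 (- ('D_a (fun z => Ga z b u) y + Ga y b (- Ga y a u))))).
rewrite [X in _ + X]E addrC opp_row_mx oppr0 opprK /Ga christoffelNr; last first.
  by move=> ? ?; exact: dg.
by rewrite -!addrA.
Qed.

Lemma christoffel_hv y u a b : U y ->
  GaT (row_mx y u) (hl y u a) (vlift b) =
    vlift (Ga y a b) + (hl y u (P lC y u a b) + vlift (P lD y u a b)).
Proof.
move=> Uy; have [p [ip py pu]] := tangent_bundle_point u Uy.
have [_ + _ _] := hC (fun k => Ck_cst k _ a) (fun k => Ck_cst k _ b) ip.
rewrite /= py pu nabla_cst /nabla.
rewrite -[vfield (fun=> b)]/(fun z : 'rV[R]_(n + n) => vlift b) (derive_cst (vlift b)) add0r -addrA.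
exact.
Qed.

Lemma christoffel_vh y u a b : U y ->
  GaT (row_mx y u) (vlift a) (hl y u b) =
    vlift (Ga y b a) + (hl y u (P lC y u b a) + vlift (P lD y u b a)).
Proof.
move=> Uy; have [p [ip py pu]] := tangent_bundle_point u Uy.
have [_ _ + _] := hC (fun k => Ck_cst k _ a) (fun k => Ck_cst k _ b) ip.
rewrite /= py pu /nabla.
rewrite -[hfield (g i) (fun=> b)]/(fun z => hlift (g i) z b).
rewrite -[vfield (fun=> a) _]/(vlift a : 'rV[R]_(n + n)) {1}/vlift derive_hlift //.
rewrite derive0 add0r => E.
rewrite -[LHS](addKr (row_mx 0 (- Ga y b a))) [X in _ + X]E.
by rewrite opp_row_mx oppr0 opprK.
Qed.

Lemma christoffel_vv y u a b : U y ->
  GaT (row_mx y u) (vlift a) (vlift b) =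
    hl y u (P lE y u b a) + vlift (P lF y u b a).
Proof.
move=> Uy; have [p [ip py pu]] := tangent_bundle_point u Uy.
have [_ _ _ +] := hC (fun k => Ck_cst k _ a) (fun k => Ck_cst k _ b) ip.
rewrite /= py pu /nabla.
rewrite -[vfield (fun=> b)]/(fun z : 'rV[R]_(n + n) => vlift b) (derive_cst (vlift b)) add0r.
exact.
Qed.

(** The error terms h{P} + v{Q} of the connection formulas vanish on the zero
    section; this computes their differential there.  The vertical part of the horizontal lift of P is
    itself of first order in u, hence of second order here: it leaves no trace
    in the limit. *)
Lemma lift_first_order l m y u a b : U y ->
  exists X : R -> 'rV[R]_(n + n),
    (forall h, hl y (h *: u) (P l y (h *: u) a b) + vlift (P m y (h *: u) a b)
       = h *: X h) /\
    X @ 0^' --> (row_mx (T_lin (g i) y (f l) u a b) (T_lin (g i) y (f m) u a b)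
       : 'rV[R]_(n + n)).
Proof.
move=> Uy; have u0 := riemannian_ge0 u Uy.
have [S [SE Sl]] := T_comb_first_order Uo Uy sg ug a b u0 (sf l).
have [V [VE Vl]] := T_comb_first_order Uo Uy sg ug a b u0 (sf m).
exists (fun h => row_mx (S h) (V h + h *: - Ga y (S h) u)); split => [h|].
  rewrite /hl hliftE /P SE VE /vlift scale_row_mx add_row_mx addr0.
  rewrite /Ga christoffelZr; last by move=> ? ?; exact: dg.
  rewrite christoffelZl; last by move=> ? ?; exact: dg.
  congr row_mx; rewrite addrC scalerDr !scalerN; congr (_ + _).
have FF : Filter (0 : R)^' by exact: dnbhs_filter.
have idc : h @[h --> (0 : R)^'] --> (0 : R) by apply: cvg_within_filter; exact: cvg_id.
apply: cvg_row_mx => //.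
have lG : linear (fun w => - Ga y w u).
  move=> s v w; rewrite /Ga christoffel_linearl ?opprD ?scalerN //.
  by move=> ? ?; exact: dg.
have := cvgZ idc (cvg_row_linear lG Sl); move=> /(_ FF); rewrite scale0r => K.
have := cvgD Vl K; move=> /(_ FF); rewrite addr0.
exact.
Qed.

Lemma hlift_zero y w : U y -> hlift (g i) (row_mx y 0) w = row_mx w 0.
Proof.
by move=> Uy; rewrite hliftE /Ga christoffel0r ?oppr0 // => ? ?; exact: dg.
Qed.

Let P0 l y a b : U y -> P l y 0 a b = 0.
Proof.
move=> Uy; have u0 := riemannian_ge0 0 Uy.
have [S [SE _]] := T_comb_first_order Uo Uy sg ug a b u0 (sf l).
by have := SE 0; rewrite !scale0r.
Qed.

(** At the zero section, horizontal and vertical vectors are the two coordinate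
    factors and the connection of the bundle is the one of the base acting on
    each of them.  In particular the zero section is totally geodesic. *)
Lemma christoffel_zero_hh y a b : U y ->
  GaT (row_mx y 0) (row_mx a 0) (row_mx b 0) = row_mx (Ga y a b) 0.
Proof.
move=> Uy; have := christoffel_hh 0 a b Uy.
rewrite !P0 // /hl !hlift_zero // => ->; rewrite /vlift row_mx0 !addr0.
have -> : 'D_a (fun z => Ga z b 0) y = 0.
  rewrite -[RHS](derive_cst 0 y a); apply: near_eq_derive.
  have : \forall z \near y, U z by exact: open_nbhs_nbhs.
  apply: filterS => z Uz; rewrite /Ga christoffel0r // => ? ?; exact: dg.
rewrite /Ga !christoffel0r ?subr0 ?row_mx0 ?addr0 //; by move=> ? ?; exact: dg.
Qed.

Lemma christoffel_zero_hv y a b : U y ->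
  GaT (row_mx y 0) (row_mx a 0) (row_mx 0 b) = row_mx 0 (Ga y a b).
Proof.
move=> Uy; have := christoffel_hv 0 a b Uy.
by rewrite !P0 // /hl !hlift_zero // => ->; rewrite /vlift !row_mx0 !addr0.
Qed.

Lemma christoffel_zero_vh y a b : U y ->
  GaT (row_mx y 0) (row_mx 0 a) (row_mx b 0) = row_mx 0 (Ga y b a).
Proof.
move=> Uy; have := christoffel_vh 0 a b Uy.
by rewrite !P0 // /hl !hlift_zero // => ->; rewrite /vlift !row_mx0 !addr0.
Qed.

Let linear_row0 : linear (fun w : 'rV[R]_n => row_mx w 0 : 'rV[R]_(n + n)).
Proof. by move=> s u v; rewrite scale_row_mx add_row_mx scaler0 addr0. Qed.

Let linear_0row : linear (fun w : 'rV[R]_n => row_mx 0 w : 'rV[R]_(n + n)).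
Proof. by move=> s u v; rewrite scale_row_mx add_row_mx scaler0 addr0. Qed.

(** The line through (y, 0) in direction (a, 0) stays in the zero section. *)
Lemma derive_zero_section (F : 'rV[R]_(n + n) -> 'rV[R]_(n + n))
    (L : 'rV[R]_n -> 'rV[R]_(n + n)) (fl : 'rV[R]_n -> 'rV[R]_n) y a :
  linear L -> U y -> derivable fl y a ->
  (forall z, U z -> F (row_mx z 0) = L (fl z)) ->
  'D_(row_mx a 0) F (row_mx y 0) = L ('D_a fl y).
Proof.
move=> lL Uy df FE; rewrite -[RHS]addr0.
apply: (derive_along_line (phi := fun=> 0) lL df); last exact: cvg_cst.
apply: filterS (near_line a Uo Uy) => h Uh.
rewrite scale_row_mx add_row_mx scaler0 addr0 !FE // scaler0 addr0.
have := lL (-1) (fl y) (fl (h *: a + y)).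
by rewrite !scaleN1r addrC => <-; rewrite addrC.
Qed.

(** The curvature of horizontal vectors involves derivatives along the zero
    section only, where the connection is the one of the base. *)
Lemma jacobi_horizontal y a b : U y ->
  jacobi (G i) (row_mx y 0) (row_mx a 0) (row_mx b 0) =
  row_mx (jacobi (g i) y a b) 0.
Proof.
move=> Uy; rewrite /jacobi riemannE; last by move=> ? ?; exact: dGT.
rewrite [in RHS]riemannE; last by move=> ? ?; exact: dg.
have E u v w : 'D_(row_mx u 0) (fun z => christoffel (G i) z (row_mx v 0) (row_mx w 0))
   (row_mx y 0) = row_mx ('D_u (fun z => Ga z v w) y) 0.
  apply: (derive_zero_section linear_row0) => //.
    exact: diff_derivable (dGa v w Uy).
  by move=> z Uz; rewrite -/GaT christoffel_zero_hh.
have Z u v : christoffel (G i) (row_mx y 0) (row_mx u 0) (row_mx v 0) =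
  row_mx (Ga y u v) 0 by exact: christoffel_zero_hh.
rewrite (E a b a) (E b a a) (Z b a) (Z a a) (Z a) (Z b).
by rewrite !opp_row_mx !add_row_mx !oppr0 !addr0.
Qed.

Let second_order_expansion (h : R) (k p q r X1 X2 X3 : 'rV[R]_(n + n)) :
  k = q + (p + p) ->
  r + h *: X1 + h *: q + h *: (p + h *: X2)
    + h *: (p + h *: X2 + h *: (h *: X3)) - r =
  h *: (k + X1 + h *: (X2 + X2 + h *: X3)).
Proof. by move=> ->; apply/rowP => j; rewrite !mxE; ring. Qed.

Let curvature_cancellation (p q r w : 'rV[R]_(n + n)) :
  p - (p + q - r + w) + q - r = - w.
Proof. by apply/rowP => j; rewrite !mxE; ring. Qed.

(** In R(a^h, b^v)a^h the only derivative that leaves the zero section is the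
    one, in direction b^v, of the covariant derivative of a^h along itself.  To
    first order in u, the latter exceeds its value on the zero section by the
    linear parts of A and B and by base Christoffel terms; these are exactly
    those that the remaining terms of the curvature remove. *)
Lemma jacobi_vertical y a b : U y ->
  jacobi (G i) (row_mx y 0) (row_mx a 0) (row_mx 0 b) =
  - row_mx (T_lin (g i) y (f lA) b a a) (T_lin (g i) y (f lB) b a a).
Proof.
move=> Uy; rewrite /jacobi riemannE; last by move=> ? ?; exact: dGT.
set c1 := Ga y a b.
have [X1 [X1E X1l]] := lift_first_order lA lB b a a Uy.
have [X2 [X2E X2l]] := lift_first_order lC lD b a c1 Uy.
have [X3 [X3E X3l]] := lift_first_order lE lF b c1 c1 Uy.
have D1 : 'D_(row_mx a 0) (fun z => christoffel (G i) z (row_mx 0 b) (row_mx a 0))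
   (row_mx y 0) = row_mx 0 ('D_a (fun z => Ga z a b) y).
  apply: (derive_zero_section linear_0row) => //.
    exact: diff_derivable (dGa a b Uy).
  by move=> z Uz; rewrite -/GaT christoffel_zero_vh.
(* The base Christoffel part of the vertical derivative. *)
set K : 'rV[R]_n := 'D_a (fun z => Ga z a b) y + Ga y a c1 - Ga y (Ga y a a) b.
have dgy u v : differentiable (fun z => bil (g i z) u v) y by exact: dg.
have D2 : 'D_(row_mx 0 b) (fun z => christoffel (G i) z (row_mx a 0) (row_mx a 0))
   (row_mx y 0) =
   row_mx 0 K + row_mx (T_lin (g i) y (f lA) b a a) (T_lin (g i) y (f lB) b a a).
  apply: (@derive_quotient_cvg _ _ _ _ _ _ (fun h => row_mx 0 K + X1 h
     + h *: (X2 h + X2 h + h *: X3 h))).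
    near=> h.
    have dGy u v : differentiable (fun z => bil (G i z) u v) (row_mx y (h *: b)).
      exact: dGT.
    rewrite scale_row_mx add_row_mx scaler0 add0r addr0 -/GaT christoffel_zero_hh //.
    (* The coordinate vector (a, 0) is not horizontal at (y, hb): it differs from
       the lift of a by h times the vertical lift of c1. *)
    have -> : row_mx a 0 = hl y (h *: b) a + h *: vlift c1.
      rewrite /hl hliftE /vlift scale_row_mx add_row_mx scaler0 addr0.
      by rewrite /c1 /Ga christoffelZr // addNr.
    have Dh : 'D_a (fun z => Ga z a (h *: b)) y = h *: 'D_a (fun z => Ga z a b) y.
      apply: etrans (deriveZ h (diff_derivable (dGa a b Uy))).
      apply: near_eq_derive; have : \forall z \near y, U z by exact: open_nbhs_nbhs.
      apply: filterS => z Uz; apply: christoffelZr => u v; exact: dg.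
    have GZ u v : Ga y u (h *: v) = h *: Ga y u v by exact: christoffelZr.
    have Eh : GaT (row_mx y (h *: b)) (hl y (h *: b) a) (hl y (h *: b) a) =
        row_mx (Ga y a a) 0 + h *: X1 h + h *: row_mx 0 (K - Ga y a c1 - Ga y a c1).
      rewrite christoffel_hh // -X1E Dh /K.
      rewrite {1}/hl hliftE -/Ga GZ GZ -/c1 GZ.
      rewrite [LHS]addrAC [RHS]addrAC; congr (_ + _).
      rewrite scale_row_mx !add_row_mx scaler0 !addr0; congr row_mx.
      move: ('D_a _ y) (Ga y (Ga y a a) b) (Ga y a c1) => p q r.
      by apply/rowP => j; rewrite !mxE; ring.
    have Ev : GaT (row_mx y (h *: b)) (hl y (h *: b) a) (vlift c1) =
        vlift (Ga y a c1) + h *: X2 h by rewrite christoffel_hv // X2E.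
    have Fv : GaT (row_mx y (h *: b)) (vlift c1) (hl y (h *: b) a) =
        vlift (Ga y a c1) + h *: X2 h by rewrite christoffel_vh // X2E.
    have Evv : GaT (row_mx y (h *: b)) (vlift c1) (vlift c1) = h *: X3 h.
      by rewrite christoffel_vv // X3E.
    have -> : GaT (row_mx y (h *: b)) (hl y (h *: b) a + h *: vlift c1)
        (hl y (h *: b) a + h *: vlift c1) =
      (GaT (row_mx y (h *: b)) (hl y (h *: b) a) (hl y (h *: b) a)
      + h *: GaT (row_mx y (h *: b)) (hl y (h *: b) a) (vlift c1))
      + h *: (GaT (row_mx y (h *: b)) (vlift c1) (hl y (h *: b) a)
      + h *: GaT (row_mx y (h *: b)) (vlift c1) (vlift c1)).
      rewrite /GaT christoffelDl // christoffelZl // !christoffelDr //.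
      by rewrite !christoffelZr.
    rewrite Eh Ev Fv Evv /vlift.
    have KE : row_mx 0 K = row_mx 0 (K - Ga y a c1 - Ga y a c1) +
       (row_mx 0 (Ga y a c1) + row_mx 0 (Ga y a c1)) :> 'rV[R]_(n + n).
      by rewrite !add_row_mx !addr0 addrA !subrK.
    exact: second_order_expansion KE.
  have FF : Filter (0 : R)^' by exact: dnbhs_filter.
  have idc : h @[h --> (0 : R)^'] --> (0 : R) by apply: cvg_within_filter; exact: cvg_id.
  have A1 := cvgD (cvg_cst (row_mx 0 K : 'rV[R]_(n + n))) X1l.
  have A2 := cvgZ idc (cvgD (cvgD X2l X2l) (cvgZ idc X3l)).
  have := cvgD (A1 FF FF) (A2 FF FF FF FF); rewrite scale0r addr0; exact.
rewrite D1 D2 -/GaT -/Ga !christoffel_zero_hh // !christoffel_zero_vh // -/c1.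
rewrite christoffel_zero_hv //.
have -> : row_mx 0 K = row_mx 0 ('D_a (fun z => Ga z a b) y)
    + row_mx 0 (Ga y a c1) - row_mx 0 (Ga y (Ga y a a) b) :> 'rV[R]_(n + n).
  by rewrite opp_row_mx !add_row_mx oppr0 !addr0.
exact: curvature_cancellation.
Unshelve. all: by end_near. Qed.

End TangentChart.

(** * Linear algebra *)

Section Spectrum.
Variable R : realType.

(** The characteristic polynomial does not depend on the basis, and the
    determinant of a triangular matrix is the product of its diagonal; it stays
    split over the reals after complexification. *)
Lemma spectrum_trig n (f : 'rV[R]_n -> 'rV[R]_n) (W L : 'M[R]_n) :
  linear f -> W \in unitmx -> is_trig_mx L ->
  (forall r, f (row r W) = row r L *m W) ->
  spectrum f = (real_complex R) @` [set L r r | r in setT].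
Proof.
move=> lf uW tL fW; set A := lin1_mx f.
pose f' : {linear 'rV[R]_n -> 'rV[R]_n} :=
  HB.pack f (GRing.isLinear.Build _ _ _ _ _ lf).
have WA : W *m A = L *m W.
  apply/row_matrixP => r; rewrite !row_mul -fW.
  exact: (mul_rV_lin1 f').
pose phi := map_mx (real_complex R).
have uW' : \det (phi n n W) != 0.
  by rewrite -unitfE -unitmxE map_unitmx.
have detE z : \det (phi n n A - z%:M) = \prod_r (real_complex R (L r r) - z).
  apply: (mulfI uW'); rewrite -det_mulmx mulmxBr -map_mxM -/A WA map_mxM.
  rewrite mul_mx_scalar -mul_scalar_mx -mulmxBl det_mulmx mulrC; congr (_ * _).
  rewrite det_trig; first by apply: eq_bigr => r _; rewrite !mxE eqxx mulr1n.
  apply/is_trig_mxP => r s rs; rewrite !mxE (is_trig_mxP tL) //.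
  by rewrite -val_eqE /= (ltn_eqF rs) mulr0n subr0 rmorph0.
apply/seteqP; split=> z.
  rewrite /spectrum /= /eigenvalue /eigenspace kermx_eq0 row_free_unit.
  rewrite unitmxE unitfE negbK -/(phi n n _) detE => /prodf_eq0[r _].
  by rewrite subr_eq0 => /eqP <-; exists (L r r) => //; exists r.
move=> [_ [r _ <-] <-]; rewrite /spectrum /= /eigenvalue /eigenspace kermx_eq0.
rewrite row_free_unit unitmxE unitfE negbK -/(phi n n _) detE.
by apply/prodf_eq0; exists r => //; rewrite subrr.
Qed.

(** For q = ((E, F), (F, K)), a rotation must send e_0 to a multiple of
    (- F, E) and e_1 to a multiple of (- K, F), by orthogonality; the common
    factor is fixed by the determinant of q. *)
Lemma quarter_turn_exists (q : 'M[R]_2) : q^T = q ->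
  (forall u, u != 0 -> 0 < bil q u u) -> exists J, quarter_turn q J.
Proof.
move=> qs qp.
have bE u v : bil q u v = u 0 0 * q 0 0 * v 0 0 + u 0 0 * q 0 1 * v 0 1
    + (u 0 1 * q 0 1 * v 0 0 + u 0 1 * q 1 1 * v 0 1).
  have q10 : q 1 0 = q 0 1 by rewrite -[in LHS]qs mxE.
  have o1 : lift ord0 ord0 = 1 :> 'I_2 by apply/val_inj.
  have o0 : ord0 = 0 :> 'I_2 by [].
  by rewrite bilE !big_ord_recl !big_ord0 /= !addr0 !o1 !o0 q10.
set E := q 0 0 in bE *; set F := q 0 1 in bE *; set K := q 1 1 in bE *.
pose vec (a b : R) : 'rV[R]_2 := \row_j (if j == 0 then a else b).
have v0 a b : vec a b 0 0 = a by rewrite mxE.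
have v1 a b : vec a b 0 1 = b by rewrite mxE.
have E0 : 0 < E.
  have := qp (vec 1 0); rewrite bE v0 v1 !mul0r !mulr0 !mul1r mulr1 !addr0; apply.
  by apply/eqP => /rowP/(_ 0); rewrite v0 mxE => /eqP; rewrite oner_eq0.
have D0 : 0 < E * K - F ^+ 2.
  (* (F, - E) is orthogonal to e_0. *)
  have := qp (vec F (- E)); rewrite bE v0 v1.
  rewrite (_ : _ + _ = E * (E * K - F ^+ 2)); last by ring.
  rewrite pmulr_rgt0 //; apply.
  by apply/eqP => /rowP/(_ 1); rewrite v1 mxE => /eqP; rewrite oppr_eq0 gt_eqF.
pose s := Num.sqrt (E * K - F ^+ 2).
have s0 : s != 0 by rewrite gt_eqF // sqrtr_gt0.
have s2 : s ^+ 2 = E * K - F ^+ 2 by rewrite sqr_sqrtr // ltW.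
exists (s^-1 *: \matrix_(i < 2) (if i == 0 then vec (- F) E else vec (- K) F)) => X.
set M := _ *: _.
have M0 : (X *m M) 0 0 = - (X 0 0 * F + X 0 1 * K) / s.
  rewrite mxE !big_ord_recl big_ord0 !mxE /=.
  have -> : lift ord0 ord0 = 1 :> 'I_2 by apply/val_inj.
  by rewrite addr0; ring.
have M1 : (X *m M) 0 1 = (X 0 0 * E + X 0 1 * F) / s.
  rewrite mxE !big_ord_recl big_ord0 !mxE /=.
  have -> : lift ord0 ord0 = 1 :> 'I_2 by apply/val_inj.
  by rewrite addr0; ring.
rewrite !bE M0 M1; move: (X 0 0) (X 0 1) => x0 x1; split; last by field.
have -> : K = (s ^+ 2 + F ^+ 2) / E by rewrite s2 subrK mulrAC mulfV ?mul1r // gt_eqF.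
have : E != 0 by rewrite gt_eqF.
by move=> E0'; field; rewrite E0'.
Qed.

End Spectrum.

(** * The spectrum of the Jacobi operator *)

Theorem proposition4p1 (R : realType) (M : manifold R 2) (g : sym_tensor M)
    (w : natural_functions R) (G : sym_tensor (tangent_bundle M))
    (f : letter -> nat -> R -> R) (k : M -> R)
    (hM : connected_manifold M) (hg : riemannian g)
    (hG : is_natural_metric w g G) (hGnd : nondegenerate_tensor G)
    (hf : connection_coefficients w f) (hk : is_curvature_function g k)
    (x : M) (H : tangent x) (i : chart M) (hi : cdom i x) :
  let z := @cmap R (2 + 2) (tangent_bundle M) i (existT _ x (zero_tangent x)) in
  let Hh := hlift (g i) z (H i) in
  let a := alpha1 w 0 + alpha3 w 0 in
  bil (G i z) Hh Hh = 1 ->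
  spectrum (jacobi (G i) z Hh) =
    (real_complex R) @`
      [set 0;
           k x / a;
           - ((f lB 6%N 0 + k x * (f lB 1%N 0 + f lB 2%N 0)) / a);
           - ((f lB 4%N 0 + f lB 5%N 0 + f lB 6%N 0) / a)].
Proof.
set y := cmap i x; set q := g i y => /=; rewrite -/y.
set z : 'rV[R]_(2 + 2) := row_mx y 0; set a := alpha1 w 0 + alpha3 w 0.
set H0 : 'rV[R]_2 := H i.
have Uy : (cmap i @` cdom i) y by exists x.
have aH : bil (G i z) (hlift (g i) z H0) (hlift (g i) z H0) = 1 ->
    a * bil q H0 H0 = 1.
  have := hG i (existT _ x (zero_tangent x)) hi H0 H0.
  rewrite /= -/y -/z -/q.
  have b0 v : bil q v 0 = 0 by rewrite /bil trmx0 mulmx0 mxE.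
  by move=> [-> _ _ _]; rewrite !b0 !mulr0 addr0.
move=> {}/aH aH; rewrite (hlift_zero g H0 Uy).
have a0 : a != 0 by apply: contra_eq_neq aH => ->; rewrite mul0r eq_sym oner_eq0.
have HH : bil q H0 H0 = a^-1 by apply: (mulfI a0); rewrite aH mulfV.
have [sf /(_ _ M g G isT hg hG hGnd) hC] := hf.
have qs : q^T = q by exact: tens_sym.
have qp u : u != 0 -> 0 < bil q u u by exact: hg.
(* The rotation J and K0 = iH give the basis (H, iH) of the tangent plane. *)
have [J hJ] := quarter_turn_exists qs qp.
set K0 : 'rV[R]_2 := H0 *m J.
have [KK KH] : bil q K0 K0 = a^-1 /\ bil q K0 H0 = 0.
  by have [] := hJ H0; rewrite HH.
have HK : bil q H0 K0 = 0 by rewrite -KH -[in LHS]qs bil_trmx.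
have rm u v c : riemann (g i) y u v c = (k x * bil q (u *m J) v) *: (c *m J).
  exact: (hk x i hi J hJ).
have jH : jacobi (g i) y H0 H0 = 0 by rewrite /jacobi rm -/K0 KH mulr0 scale0r.
have jK : jacobi (g i) y H0 K0 = (k x / a) *: K0 by rewrite /jacobi rm -/K0 KK.
pose e l := (f l 4%N 0 + f l 5%N 0 + f l 6%N 0) / a.
pose d l := (f l 6%N 0 + k x * (f l 1%N 0 + f l 2%N 0)) / a.
have TH l : T_lin (g i) y (f l) H0 H0 H0 = e l *: H0.
  by rewrite /T_lin rm -/K0 KH -/q HH /e; apply/rowP => j; rewrite !mxE; ring.
have TK l : T_lin (g i) y (f l) K0 H0 H0 = d l *: K0.
  by rewrite /T_lin rm -/K0 KK -/q HH HK /d; apply/rowP => j; rewrite !mxE; ring.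
pose B : 'M[R]_2 := \matrix_(r < 2) (if r == 0 then H0 else K0).
pose D (d0 d1 : R) : 'M[R]_2 := diag_mx (\row_j (if j == 0 then d0 else d1)).
have rB r : row r B = if r == 0 then H0 else K0 by rewrite rowK.
have rD d0 d1 r : row r (D d0 d1) *m B =
    (if r == 0 then d0 else d1) *: (if r == 0 then H0 else K0).
  by rewrite row_diag_mx -scalemxAl -rowE rB mxE.
(* H and iH are orthogonal with common squared length 1 / a: B q B^T = 1 / a. *)
have uB : B \in unitmx.
  have E : B *m (q *m B^T *m (a%:M)) = 1%:M.
    rewrite mul_mx_scalar -scalemxAr mulmxA; apply/matrixP => r s.
    have -> : (a *: (B *m q *m B^T)) r s = a * bil q (row r B) (row s B).
      by rewrite /bil -row_mul tr_row !mxE; congr (_ * _); apply: eq_bigr => t _; rewrite !mxE.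
    rewrite !rB; case: (eqVneq r s) => [->|rs].
      by case: ifP => _; rewrite ?HH ?KK mulfV // mxE eqxx.
    rewrite mxE (negbTE rs); case: r rs => [[|[|//]] r1]; case: s => [[|[|//]] s1] //= _;
      by rewrite ?HK ?KH mulr0.
  by have [] := mulmx1_unit E.
(* In the basis H^h, (iH)^h, H^v, (iH)^v the matrix is lower triangular: the
   horizontal vectors span an invariant plane. *)
pose W : 'M[R]_(2 + 2) := block_mx B 0 0 B.
pose L : 'M[R]_(2 + 2) :=
  block_mx (D 0 (k x / a)) 0 (- D (e lA) (d lA)) (- D (e lB) (d lB)).
have uW : W \in unitmx by rewrite unitmxE det_ublock unitrM -!unitmxE uB.
have tL : is_trig_mx L.
  rewrite is_trig_block_mx // eqxx /= diag_mx_is_trig /=.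
  apply/is_trig_mxP => r s rs; rewrite mxE.
  by rewrite (is_trig_mxP (diag_mx_is_trig _)) // oppr0.
have lin : linear (jacobi (G i) z (row_mx H0 0)).
  exact: (@jacobi_linear _ _ (tangent_bundle M) G i (existT _ x (zero_tangent x))).
rewrite (spectrum_trig lin uW tL).
  congr (_ @` _); rewrite -/(e lB) -/(d lB).
  have Dr d0 d1 r : D d0 d1 r r = if r == 0 then d0 else d1.
    by rewrite !mxE eqxx mulr1n.
  have Ll r : L (lshift 2 r) (lshift 2 r) = if r == 0 then 0 else k x / a.
    by rewrite /L block_mxEul Dr.
  have Lr r : L (rshift 2 r) (rshift 2 r) = - (if r == 0 then e lB else d lB).
    by rewrite /L block_mxEdr mxE Dr.
  apply/seteqP; split=> t.
    move=> [r _ <-]; rewrite -(splitK r); case: (fintype.split r) => r' /=.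
      by rewrite Ll; case: ifP => _; [do 3!left|do 2!left; right].
    by rewrite Lr; case: ifP => _; [right|left; right].
  move=> [[[->|->]|->]|->].
  - by exists (lshift 2 0) => //; rewrite Ll.
  - by exists (lshift 2 1) => //; rewrite Ll.
  - by exists (rshift 2 1) => //; rewrite Lr.
  - by exists (rshift 2 0) => //; rewrite Lr.
move=> r; rewrite -(splitK r); case: (fintype.split r) => r' /=.
  rewrite /W /L /block_mx !rowKu !row_row_mx row0 mul_row_col.
  rewrite (jacobi_horizontal hg sf hC) // rB mul0mx addr0 mul_mx_row mulmx0 rD.
  by congr row_mx; case: ifP => _; rewrite ?jH ?jK ?scale0r.
rewrite /W /L /block_mx !rowKd !row_row_mx row0 mul_row_col.
rewrite (jacobi_vertical hg sf hC) // rB !mul_mx_row !mulmx0 !add_row_mx addr0 add0r.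
rewrite !linearN /= !mulNmx !rD opp_row_mx.
by congr row_mx; case: ifP => _; rewrite ?TH ?TK.
Qed.
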